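(* Let $\tau>0$, let $W\in W^{1,2}_{loc}(\mathbb{R}^d)$ with $\int_{\mathbb{R}^d}|x|^2e^{-W}dx<\infty$, and let $\mu,\sigma\in\mathcal{P}_2(\mathbb{R}^d\times\mathcal{G})$ be absolutely continuous with respect to $dx\,dg$ with $\mathcal{A}^{\mathcal{G},W,\tau}(\mu,\sigma)<\infty$. Let $(\gamma,h)\in ADM(\mu,\sigma)$ and assume that, for every $g\in\mathcal{G}$, the density of $\mu_g$ and the density $\bar f_g:=\sigma_g+\tau\sum_{g'}h_{gg'}K(g,g')e^{-W}$ of $\pi_{2\#}\gamma_g$ are strictly positive. Then the following are equivalent: (i) $C_\tau(\gamma,h)$ is minimal among all pairs in $ADM(\mu,\sigma)$. (ii) There exist functions $\phi,\psi:\mathbb{R}^d\times\mathcal{G}\to\mathbb{R}$ such that: (a) for every $g\in\mathcal{G}$, $\phi_g(\cdot)=\phi(\cdot,g)$ is $c$-concave and the plan $\gamma_g$ is supported on $\partial^c_+\phi_g$; (b) for Lebesgue almost every $y\in\mathbb{R}^d$ the function $\psi_y(\cdot)=\psi(y,\cdot)$ satisfies $\psi_y(g')-\psi_y(g)=h_{gg'}(y)$ for all $g,g'$ with $K(g,g')>0$; (c) $\phi-\psi\in\Phi^\perp$. (iii) There exists a single potential $\varphi:\mathbb{R}^d\times\mathcal{G}\to\mathbb{R}$ such that (a), (b), (c) of (ii) hold with $\phi=\psi=\varphi$.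
   Context: $\mathcal{G}$ is a finite set and $K:\mathcal{G}\times\mathcal{G}\to[0,\infty)$ is symmetric; $(\mathcal{G},K)$ is connected, i.e. any $g,g'$ are joined by a path $g_0=g,\dots,g_m=g'$ with $K(g_l,g_{l+1})>0$. $dg$ is counting measure on $\mathcal{G}$; $\mathcal{P}_2(\mathbb{R}^d\times\mathcal{G})$ is the set of Borel probability measures with finite second moment. Every such $\mu$ is written $\mu=\sum_g\mu_g\otimes\delta_g$ with $\mu_g$ positive measures on $\mathbb{R}^d$; absolutely continuous measures are identified with their densities. Static problem: $ADM(\mu,\sigma)$ is the set of pairs $(\gamma,h)$ where (1) $\gamma=\{\gamma_g\}_{g\in\mathcal{G}}$, each $\gamma_g$ a positive Borel measure on $\mathbb{R}^d\times\mathbb{R}^d$ with first marginal $\pi_{1\#}\gamma_g=\mu_g$; (2) $h=(h_{gg'}(x)):\mathbb{R}^d\times\mathcal{G}\times\mathcal{G}\to\mathbb{R}$ satisfies $h_{gg'}=-h_{g'g}$ and $\sum_{g,g'}\int h_{gg'}^2e^{-W}K(g,g')dx<\infty$; (3) for every $g$, $\sigma_g=\pi_{2\#}\gamma_g-\tau\sum_{g'}h_{gg'}(x)K(g,g')e^{-W(x)}dx$. Set $$C_\tau(\gamma,h)=\sum_g\frac1{2\tau}\int_{\mathbb{R}^d\times\mathbb{R}^d}|x-x'|^2d\gamma_g(x,x')+\frac{\tau}{4}\sum_{g,g'}\int_{\mathbb{R}^d}h_{gg'}^2K(g,g')e^{-W}dx,$$ and $\mathcal{A}^{\mathcal{G},W,\tau}(\mu,\sigma)=\inf_{ADM(\mu,\sigma)}C_\tau$,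 with $\inf\emptyset=+\infty$. $c$-concavity: let $c(x,y)=\frac1{2\tau}|x-y|^2$. A function $\varphi:\mathbb{R}^d\to\mathbb{R}$ is $c$-concave if $\varphi(y)=\inf_{x\in\mathbb{R}^d}c(x,y)-\eta(x)$ for all $y$, for some $\eta:\mathbb{R}^d\to\mathbb{R}$. Its $c$-transform is $\varphi^c(x)=\inf_{y\in\mathbb{R}^d}c(x,y)-\varphi(y)$, and $\partial^c_+\varphi=\{(x,y):\varphi^c(x)+\varphi(y)=c(x,y)\}$. $\Phi$ is the set of $\varepsilon\in L^2(\mathbb{R}^d\times\mathcal{G})$ with compact support such that $\int_{\mathbb{R}^d}\varepsilon(x,g)dx=0$ for all $g$ and $\sum_g\varepsilon(x,g)=0$ for a.e. $x$. $\Phi^\perp$ is the set of $\varphi\in L^2_{loc}(\mathbb{R}^d\times\mathcal{G})$ with $\int_{\mathbb{R}^d}\sum_g\varphi(x,g)\varepsilon(x,g)dx=0$ for all $\varepsilon\in\Phi$. *)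

(* Defs.v *)
From HB Require Import structures.
From mathcomp Require Import all_boot all_order all_algebra.
From mathcomp Require Import all_classical all_reals all_analysis.
From mathcomp Require Import measurable_realfun.

Set Implicit Arguments.
Unset Strict Implicit.
Unset Printing Implicit Defensive.

Import Order.TTheory GRing.Theory Num.Theory.
Import numFieldNormedType.Exports.

Local Open Scope classical_set_scope.
Local Open Scope ring_scope.

Section borel_mx.
Variables (R : realType) (m n : nat).
Let B := (@open 'M[R]_(m, n)).

HB.instance Definition _ := @isMeasurable.Build (sigma_display B) 'M[R]_(m, n)
  <<s B >> (@sigma_algebra0 _ setT B) (@sigma_algebraC _ B)
  (@sigma_algebra_bigcup _ setT B).

End borel_mx.

Section borel_rV.
Context {R : realType}.

Lemma measurable_coord n (i : 'I_n) :
  measurable_fun [set: 'rV[R]_n] (fun x : 'rV[R]_n => x ord0 i).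
Proof.
apply: (measurability _ (RGenOpens.measurableE R)) => //.
move=> /= _ [_ [a [b ->] <-]]; rewrite setTI.
apply: sub_sigma_algebra; apply: open_comp; last exact: interval_open.
by move=> x _; exact: coord_continuous.
Qed.

Lemma measurable_fun_rVP d (T : measurableType d) n (f : T -> 'rV[R]_n) :
  (forall i, measurable_fun [set: T] (fun t => f t ord0 i)) ->
  measurable_fun [set: T] f.
Proof.
move=> mf; apply: (measurability (@open 'rV[R]_n)) => //.
move=> /= _ [U oU <-]; rewrite setTI.
pose box (p : 'rV[rat]_n * 'rV[rat]_n) : set 'rV[R]_n :=
  [set x | forall i, x ord0 i \in `]ratr (p.1 ord0 i), ratr (p.2 ord0 i)[].
pose boxU p : set 'rV[R]_n := [set x | box p x /\ box p `<=` U].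
have -> : U = \bigcup_p boxU p.
  apply/seteqP; split => [x Ux|x [p _ [bx]]]; last by apply.
  have /nbhs_ballP[e /= e0 xeU] : nbhs x U by exact: open_nbhs_nbhs.
  have lo i : x ord0 i - e < x ord0 i by rewrite ltrBlDr ltrDl.
  have hi i : x ord0 i < x ord0 i + e by rewrite ltrDl.
  have /choice[a Ha] : forall i, exists q : rat,
      ratr q \in `](x ord0 i - e), (x ord0 i)[.
    by move=> i; have [q] := rat_in_itvoo (lo i); exists q.
  have /choice[b Hb] : forall i, exists q : rat,
      ratr q \in `](x ord0 i), (x ord0 i + e)[.
    by move=> i; have [q] := rat_in_itvoo (hi i); exists q.
  exists (\row_i a i, \row_i b i) => //; split.
    move=> i; rewrite /= !mxE in_itv/=.
    by rewrite (itvP (Ha i)) (itvP (Hb i)).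
  move=> y yab; apply: xeU; split => // j i; rewrite [j]ord1.
  have := yab i; rewrite /= !mxE in_itv/= => /andP[ay yb].
  rewrite /ball/= ltr_distlC; apply/andP; split.
    by apply: lt_trans ay; rewrite (itvP (Ha i)).
  by apply: (lt_trans yb); rewrite (itvP (Hb i)).
rewrite preimage_bigcup; apply: countable_bigcupT_measurable => // p.
have [pU|npU] := pselect (box p `<=` U); last first.
  rewrite [X in measurable X](_ : _ = set0)//.
  by apply/seteqP; split => // t [].
rewrite [X in measurable X](_ : _ = \bigcap_(i in [set: 'I_n])
    ((fun t => f t ord0 i) @^-1` `]ratr (p.1 ord0 i), ratr (p.2 ord0 i)[)).
  apply: fin_bigcap_measurable => // i _; rewrite -[X in measurable X]setTI.
  exact: mf.
apply/seteqP; split => t /=; first by move=> [+ _] i _; exact.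
by move=> H; split => // i; exact: H.
Qed.

End borel_rV.

(* Lebesgue measure on R^n, by recursion on n: R^(n+1) is identified with
   R x R^n, and R^0 carries the unit mass. *)
Section lebesgue_rV.
Context {R : realType}.

Definition rV_cons n (p : measurableTypeR R * 'rV[R]_n) : 'rV[R]_n.+1 :=
  (row_mx (const_mx (p.1 : R) : 'rV[R]_1) p.2 : 'rV[R]_(1 + n)).

Lemma rV_cons0 n p : @rV_cons n p ord0 ord0 = p.1.
Proof.
have := row_mxEl (const_mx (p.1 : R) : 'rV[R]_1) p.2 ord0 ord0.
by rewrite [RHS]mxE => <-; congr (rV_cons p ord0 _); exact/val_inj.
Qed.

Lemma rV_consS n p i : @rV_cons n p ord0 (lift ord0 i) = p.2 ord0 i.
Proof.
have <- := row_mxEr (const_mx (p.1 : R) : 'rV[R]_1) p.2 ord0 i.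
by congr (rV_cons p ord0 _); exact/val_inj.
Qed.

Lemma measurable_rV_cons n : measurable_fun [set: _ * _] (@rV_cons n).
Proof.
apply: measurable_fun_rVP => i; case: (unliftP ord0 i) => [j ->|->].
  under eq_fun do rewrite rV_consS.
  apply: (measurableT_comp (measurable_coord j)); exact: measurable_snd.
under eq_fun do rewrite rV_cons0.
exact: measurable_fst.
Qed.

Definition rV_uncons n (x : 'rV[R]_n.+1) : measurableTypeR R * 'rV[R]_n :=
  (x ord0 ord0, \row_i x ord0 (lift ord0 i)).

Lemma rV_consK n : cancel (@rV_cons n) (@rV_uncons n).
Proof.
move=> [a x]; rewrite /rV_uncons rV_cons0; congr (_, _).
by apply/rowP => i; rewrite mxE rV_consS.
Qed.

Lemma rV_unconsK n : cancel (@rV_uncons n) (@rV_cons n).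
Proof.
move=> x; apply/rowP => i; case: (unliftP ord0 i) => [j ->|->].
  by rewrite rV_consS mxE.
by rewrite rV_cons0.
Qed.

Lemma measurable_rV_uncons n : measurable_fun setT (@rV_uncons n).
Proof.
apply: measurable_fun_pair; first exact: measurable_coord.
apply: measurable_fun_rVP => i; under eq_fun do rewrite mxE.
exact: measurable_coord.
Qed.

Section step.
Variables (n : nat) (m : {sigma_finite_measure set 'rV[R]_n -> \bar R}).

Definition lebesgue_cons : set 'rV[R]_n.+1 -> \bar R :=
  pushforward (@lebesgue_measure R \x m)%E (@rV_cons n).

Let mu : {measure set 'rV[R]_n.+1 -> \bar R} :=
  measure_function_pushforward__canonical__measure_function_Measure
    (@lebesgue_measure R \x m)%E (@measurable_rV_cons n).

Let lc0 : lebesgue_cons set0 = 0%E.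
Proof. exact: (measure0 mu). Qed.

Let lc_ge0 A : (0 <= lebesgue_cons A)%E.
Proof. exact: (measure_ge0 mu). Qed.

Let lc_sigma_additive : semi_sigma_additive lebesgue_cons.
Proof. exact: (@measure_semi_sigma_additive _ _ _ mu). Qed.

HB.instance Definition _ := isMeasure.Build _ _ _ lebesgue_cons
  lc0 lc_ge0 lc_sigma_additive.

Let lc_sigma_finite : sigma_finite setT lebesgue_cons.
Proof.
have /sigma_finiteP[F [FT ndF Foo]] := sigma_finiteT (@lebesgue_measure R).
have /sigma_finiteP[H [HT ndH Hoo]] := sigma_finiteT m.
exists (fun k => @rV_uncons n @^-1` (F k `*` H k)).
  rewrite -preimage_bigcup -[LHS](preimage_setT (@rV_uncons n)); congr (_ @^-1` _).
  apply/seteqP; split => // -[a x] _.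
  have [i _ Fi] : (\bigcup_k F k) a by rewrite -FT.
  have [j _ Hj] : (\bigcup_k H k) x by rewrite -HT.
  exists (maxn i j) => //; split => /=.
    by move: a Fi; exact/subsetPset/ndF/leq_maxl.
  by move: x Hj; exact/subsetPset/ndH/leq_maxr.
move=> k; have [mF Fk] := Foo k; have [mH Hk] := Hoo k; split.
  rewrite -[X in measurable X]setTI; apply: measurable_rV_uncons => //.
  exact: measurableX.
rewrite /lebesgue_cons /pushforward -comp_preimage.
rewrite (_ : _ \o _ = id); last by apply/funext => p; exact: rV_consK.
by rewrite preimage_id product_measure1E// lte_mul_pinfty// ge0_fin_numE.
Qed.

HB.instance Definition _ := Measure_isSigmaFinite.Build _ _ _ lebesgue_cons
  lc_sigma_finite.

End step.

Fixpoint lebesgue_rV n : {sigma_finite_measure set 'rV[R]_n -> \bar R} :=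
  match n with
  | 0%N => dirac (0 : 'rV[R]_0)
  | n.+1 => lebesgue_cons (lebesgue_rV n)
  end.

Lemma lebesgue_rV_box n (A : 'I_n -> set (measurableTypeR R)) :
  (forall i, measurable (A i)) ->
  lebesgue_rV n [set x : 'rV[R]_n | forall i, A i (x ord0 i)] =
  (\prod_(i < n) @lebesgue_measure R (A i))%E.
Proof.
elim: n A => [|n IH] A mA.
  by rewrite big_ord0 /= diracE mem_set//= => -[].
rewrite big_ord_recl -IH// -product_measure1E//; last first.
  rewrite (_ : [set x : 'rV[R]_n | _] = \bigcap_(i in [set: 'I_n])
    ((fun x : 'rV[R]_n => x ord0 i) @^-1` A (lift ord0 i))); last first.
    by apply/seteqP; split => x /= H i; [move=> _|]; exact: H.
  apply: fin_bigcap_measurable => // i _; rewrite -[X in measurable X]setTI.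
  by apply: measurable_coord => //; exact: mA.
rewrite /= /lebesgue_cons /pushforward; congr (product_measure1 _ _ _).
apply/seteqP; split => [[a x] H|[a x] [/= H0 H] i] /=.
  split => /= [|i]; first by have := H ord0; rewrite rV_cons0.
  by have := H (lift ord0 i); rewrite rV_consS.
by case: (unliftP ord0 i) => [j ->|->]; rewrite ?rV_consS ?rV_cons0//; exact: H.
Qed.

End lebesgue_rV.

Section sobolev.
Context {R : realType} {d : nat}.
Notation Rd := 'rV[R]_d.
Notation leb := (@lebesgue_rV R d).

Definition partial (i : 'I_d) (f : Rd -> R) : Rd -> R :=
  fun x => 'D_(delta_mx 0 i) (f : Rd -> R^o) x.

Definition smooth (f : Rd -> R) : Prop :=
  forall s : seq 'I_d, let g := foldr partial f s in
    continuous g /\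
    forall i x, derivable (g : Rd -> R^o) x (delta_mx 0 i).

Definition test_function (f : Rd -> R) : Prop :=
  smooth f /\ compact (closure [set x | f x != 0]).

Definition L2loc (f : Rd -> R) : Prop :=
  measurable_fun [set: Rd] f /\
  forall A : set Rd, compact A ->
    (\int[leb]_(x in A) ((f x) ^+ 2)%:E < +oo)%E.

Definition weak_partial (i : 'I_d) (f g : Rd -> R) : Prop :=
  forall xi, test_function xi ->
    (\int[leb]_x (f x * partial i xi x)%:E = - \int[leb]_x (g x * xi x)%:E)%E.

Definition W12loc (f : Rd -> R) : Prop :=
  L2loc f /\ forall i, exists2 g, L2loc g & weak_partial i f g.

End sobolev.

Section graph_transport.
Context {R : realType} {d : nat} {G : finType}.
Notation Rd := 'rV[R]_d.
Notation leb := (@lebesgue_rV R d).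

(* The library norm on matrices is the sup norm; |x| is the Euclidean norm. *)
Definition sqnorm (x : Rd) : R := \sum_i (x ord0 i) ^+ 2.

(* A measure mu on R^d x G is given by its slices mu_g, i.e.
   mu = \sum_g mu_g (x) delta_g. *)
Definition P2 (mu : G -> {finite_measure set Rd -> \bar R}) : Prop :=
  (\sum_g mu g setT = 1)%E /\
  (\sum_g \int[mu g]_x (sqnorm x)%:E < +oo)%E.

(* Absolute continuity with respect to dx dg, dg being counting measure. *)
Definition abs_cont (mu : G -> {finite_measure set Rd -> \bar R}) : Prop :=
  forall g, mu g `<< leb.

Definition density (nu : {finite_measure set Rd -> \bar R}) : Rd -> \bar R :=
  Radon_Nikodym (charge_of_finite_measure nu) leb.

Section problem.
Variables (K : G -> G -> R) (W : Rd -> R) (tau : R).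
Implicit Types (mu sigma : G -> {finite_measure set Rd -> \bar R}).
Implicit Types (gamma : G -> {measure set (Rd * Rd) -> \bar R}).
Implicit Types (h : G -> G -> Rd -> R).

Definition exchange h (g : G) (x : Rd) : R :=
  tau * \sum_g' h g g' x * K g g' * expR (- W x).

Definition h_energy h : \bar R :=
  (\sum_g \sum_g' \int[leb]_x ((h g g' x) ^+ 2 * K g g' * expR (- W x))%:E)%E.

(* The last identity, on {exchange h g > 0} and {exchange h g < 0}, forces
   [exchange h g] to be integrable. *)
Definition ADM mu sigma gamma h : Prop :=
  [/\ forall g A, measurable A -> gamma g (A `*` setT) = mu g A,
      forall g g', measurable_fun [set: Rd] (h g g'),
      forall g g' x, h g g' x = - h g' g x,
      (h_energy h < +oo)%E &
      forall g A, measurable A ->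
        (sigma g A =
         gamma g (setT `*` A) - \int[leb]_(x in A) (exchange h g x)%:E)%E].

Definition total_cost gamma h : \bar R :=
  (\sum_g (2 * tau)^-1%:E *
      \int[gamma g]_p (sqnorm (p.1 - p.2))%:E
   + (tau / 4)%:E * h_energy h)%E.

Definition min_cost mu sigma : \bar R :=
  ereal_inf [set total_cost p.1 p.2 | p in [set p | ADM mu sigma p.1 p.2]].

Definition fbar sigma h (g : G) (x : Rd) : \bar R :=
  (density (sigma g) x + (exchange h g x)%:E)%E.

Definition cost (x y : Rd) : R := sqnorm (x - y) / (2 * tau).

(* Infima are taken in the extended reals: [inf] on R is 0 on unbounded sets. *)
Definition c_concave (phi : Rd -> R) : Prop :=
  exists eta : Rd -> R, forall y,
    (phi y)%:E = ereal_inf [set (cost x y - eta x)%:E | x in setT].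

Definition c_transform (phi : Rd -> R) (x : Rd) : \bar R :=
  ereal_inf [set (cost x y - phi y)%:E | y in setT].

Definition c_superdiff (phi : Rd -> R) : set (Rd * Rd) :=
  [set p | (c_transform phi p.1 + (phi p.2)%:E = (cost p.1 p.2)%:E)%E].

Definition Phi : set (G -> Rd -> R) :=
  [set eps |
    [/\ forall g, eps g \in Lfun leb 2%:E,
        exists2 A : set Rd, compact A &
          forall g, {ae leb, forall x, ~ A x -> eps g x = 0},
        forall g, (\int[leb]_x (eps g x)%:E = 0)%E &
        {ae leb, forall x, \sum_g eps g x = 0}]].

Definition Phi_orth : set (G -> Rd -> R) :=
  [set phi | (forall g, L2loc (phi g)) /\
    forall eps, Phi eps ->
      (\int[leb]_x (\sum_g phi g x * eps g x)%:E = 0)%E].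

Definition potentials gamma h (phi psi : G -> Rd -> R) : Prop :=
  [/\ forall g, c_concave (phi g) /\
        (gamma g).-negligible (~` c_superdiff (phi g)),
      {ae leb, forall y g g', 0 < K g g' -> psi g' y - psi g y = h g g' y} &
      Phi_orth (fun g x => phi g x - psi g x)].

End problem.
End graph_transport.

(* Main.v *)
Require Import Defs.
From HB Require Import structures.
From mathcomp Require Import all_boot all_order all_algebra.
From mathcomp Require Import all_classical all_reals all_analysis.
From mathcomp Require Import measurable_realfun ring lra.

(* The problem behaves like one transport problem on R^d x G in which a point
   may be transported inside a layer at cost c, or change layer at y at the
   marginal cost h_gg'(y). Moving small masses cyclically shows that at a
   minimizer every cycle built from typical points (x_i, y_i) of the plans
   gamma_(g_i), with g_i = g_(i+1) or K(g_i, g_(i+1)) > 0, satisfies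
     sum_i c(x_i, y_(i+1)) - c(x_i, y_i) + h_(g_i g_(i+1))(y_(i+1)) >= 0.
   Shortest-path distances for these weights then give, as in Rockafellar's
   construction, one function phi(y, g) that is c-concave in y with the right
   superdifferential, and the two opposite edges between g and g' force
   phi_g' - phi_g = h_gg'. Positivity of the densities makes phi and its
   transform finite everywhere. This avoids any stability of dual potentials.

   Conversely, a common potential certifies optimality by Kantorovich duality
   in each layer and convexity of the energy; integrability of the single
   terms phi_g (f'_g - f_g) follows from that of their sum, each of them being
   bounded above by an integrable function.

   An element of the orthogonal of Phi is a.e. of the form a(y) + b(g), so that
   the pair (phi, psi) can be replaced by phi - b. *)

Set Implicit Arguments.
Unset Strict Implicit.
Unset Printing Implicit Defensive.

Import Order.TTheory GRing.Theory Num.Theory.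
Import numFieldNormedType.Exports.

Local Open Scope classical_set_scope.
Local Open Scope ring_scope.

(** * Measure-theoretic preliminaries *)

(** The function [h] is merely measurable, so the support of a plan in the usual sense says nothing
    about the values of [h]. Typical points take its place: a pair is typical when every set on
    which the coordinates, [W], the target density and all [h_ab] stay close to their values at the
    pair has positive mass. On such a set these data are bounded, which keeps the perturbed pair
    admissible, and they are constant up to a small error, so that the first variation reads off the
    weight of the cycle. Moving mass [t] changes the cost by [t] times this weight plus a term of
    order [t^2], the energy of the perturbation.

    Connectedness of the graph gives walks from one base pair to the typical pairs of all layers at
    once. Positivity of the densities turns a property of typical pairs into one of Lebesgue-almost
    every point. Passing from almost every to every point relies on the quadratic cost: a null set
    and its mirror image in [a] cannot cover the space, so [a] is the midpoint of two good
    points. *)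

Section typical_points.
Context d (T : measurableType d) (R : realType) (J : finType).
Variables (m : {measure set T -> \bar R}) (F : J -> T -> R).
Hypothesis mF : forall j, measurable_fun setT (F j).

Definition feature_nbhs (p : T) (e : R) : set T :=
  [set p' | forall j, `|F j p' - F j p| < e].

(** The points whose feature vector lies in the support of the image of [m] under [F], a measure on
    the finite-dimensional space of features. *)
Definition typical : set T :=
  [set p | forall e, 0 < e -> (0 < m (feature_nbhs p e))%E].

Lemma measurable_feature_nbhs p e : measurable (feature_nbhs p e).
Proof.
rewrite (_ : feature_nbhs p e = \bigcap_(j in [set: J])
    (F j @^-1` [set x | `|x - F j p| < e])); last first.
  by apply/seteqP; split => x /= H j; [move=> _|]; exact: H.
apply: fin_bigcap_measurable => // j _; rewrite -[X in measurable X]setTI.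
apply: mF => //; rewrite [X in measurable X](_ : _ =
  `](F j p - e), (F j p + e)[%classic) //.
by apply/seteqP; split => x /=; rewrite in_itv/= ltr_distl.
Qed.

Let box (q : {ffun J -> rat * rat}) : set T :=
  [set p | forall j, F j p \in `]ratr (q j).1, ratr (q j).2[].

Let measurable_box q : measurable (box q).
Proof.
rewrite (_ : box q = \bigcap_(j in [set: J])
    (F j @^-1` `]ratr (q j).1, ratr (q j).2[)); last first.
  by apply/seteqP; split => x /= H j; [move=> _|]; exact: H.
apply: fin_bigcap_measurable => // j _; rewrite -[X in measurable X]setTI.
exact: mF.
Qed.

(** A feature neighbourhood contains a rational box around the features of its centre. A point that
    is not typical therefore lies in one of countably many null boxes. *)
Lemma ae_typical : m.-negligible (~` typical).
Proof.
(* The null rational boxes, enumerated through their codes; every other index gives the empty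
   set. *)
pose N n := if unpickle n is Some q then
  if m (box q) == 0%E then box q else set0 else set0.
apply: (@negligibleS _ _ _ _ (\bigcup_n N n)); last first.
  apply: negligible_bigcup => n; rewrite /N.
  case: (unpickle n) => [q|]; last exact: negligible_set0.
  case: eqP => [mq|_]; last exact: negligible_set0.
  exact/negligibleP.
move=> p /existsNP[e] /not_implyP[e0] /negP; rewrite -leNgt => me.
have lo j : F j p - e < F j p by rewrite ltrBlDr ltrDl.
have hi j : F j p < F j p + e by rewrite ltrDl.
have /choice[a Ha] : forall j, exists q : rat,
    ratr q \in `](F j p - e), (F j p)[.
  by move=> j; have [q] := rat_in_itvoo (lo j); exists q.
have /choice[b Hb] : forall j, exists q : rat,
    ratr q \in `](F j p), (F j p + e)[.
  by move=> j; have [q] := rat_in_itvoo (hi j); exists q.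
pose q := [ffun j => (a j, b j)].
have bp : box q p.
  by move=> j; rewrite ffunE/= in_itv/= (itvP (Ha j)) (itvP (Hb j)).
exists (pickle q) => //; rewrite /N pickleK.
suff -> : m (box q) == 0%E by [].
rewrite -measure_le0 (le_trans _ me)// le_measure ?inE//.
  exact: measurable_feature_nbhs.
move=> p' bp' j; have := bp' j; rewrite ffunE/= in_itv/= => /andP[h1 h2].
rewrite ltr_distl; apply/andP; split.
  by apply: lt_trans h1; rewrite (itvP (Ha j)).
by apply: (lt_trans h2); rewrite (itvP (Hb j)).
Qed.

End typical_points.

(** * Invariance of Lebesgue measure under point reflections *)

Section reflection.
Context {R : realType}.

Lemma reflectE n (a y : 'rV[R]_n) i j : (a *+ 2 - y) i j = a i j *+ 2 - y i j.
Proof. by rewrite !mxE mulr2n. Qed.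

Lemma measurable_reflect n (a : 'rV[R]_n) :
  measurable_fun [set: 'rV[R]_n] (fun y => a *+ 2 - y).
Proof.
apply: measurable_fun_rVP => i; under eq_fun do rewrite reflectE.
by apply: measurable_funB => //; exact: measurable_coord.
Qed.

Lemma lebesgue_reflect (a : R) (A : set (measurableTypeR R)) :
  measurable A -> lebesgue_measure ((fun y => a *+ 2 - y) @^-1` A) =
    lebesgue_measure A.
Proof.
have mr : measurable_fun setT
    (fun y : measurableTypeR R => (a *+ 2 - y : measurableTypeR R)).
  exact: measurable_funB.
pose m' : {measure set (measurableTypeR R) -> \bar R} :=
  measure_function_pushforward__canonical__measure_function_Measure
    (@lebesgue_measure R) mr.
move=> mA; apply/esym; rewrite (@lebesgue_measure_unique R m')//.
move=> _ [[x y]] _ <-; rewrite /m'/= /pushforward.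
rewrite (_ : _ @^-1` _ = `[(a *+ 2 - y), (a *+ 2 - x)[%classic); last first.
  by apply/seteqP; split => z /=; rewrite !in_itv/=; lra.
rewrite !lebesgue_measure_itv/= !lte_fin ltrD2l ltrN2.
by case: ifP => // _; rewrite -!EFinB; congr EFin; lra.
Qed.

(** [lebesgue_rV] is built one coordinate at a time, and so is its invariance: a reflection acts
    separately on the first coordinate and on the rest, and the product measure is determined by its
    values on rectangles. *)
Lemma lebesgue_rV_reflect n (a : 'rV[R]_n) (A : set 'rV[R]_n) :
  measurable A -> lebesgue_rV n ((fun y => a *+ 2 - y) @^-1` A) =
    lebesgue_rV n A.
Proof.
elim: n => [|n IH] in a A *.
  move=> _; congr (lebesgue_rV 0 _); apply/seteqP.
  by split => x /=; rewrite [_ - x]thinmx0 [x]thinmx0.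
move=> mA; rewrite /= /lebesgue_cons /pushforward.
pose a' : 'rV[R]_n := \row_i a ord0 (lift ord0 i).
pose T1 (y : measurableTypeR R) : measurableTypeR R := a ord0 ord0 *+ 2 - y.
pose T2 (y : 'rV[R]_n) := a' *+ 2 - y.
have mT1 : measurable_fun setT T1 by exact: measurable_funB.
have mT2 : measurable_fun setT T2 by exact: measurable_reflect.
pose T p := (T1 p.1, T2 p.2).
have mT : measurable_fun setT T.
  by apply: measurable_fun_pair; apply: measurableT_comp.
pose m' : {measure set (measurableTypeR R * 'rV[R]_n) -> \bar R} :=
  measure_function_pushforward__canonical__measure_function_Measure
    (@lebesgue_measure R \x lebesgue_rV n)%E mT.
rewrite [RHS](@product_measure_unique _ _ _ _ _ _ _ m'); last 2 first.
  move=> B C mB mC; rewrite /m'/= /pushforward.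
  rewrite (_ : T @^-1` (B `*` C) = (T1 @^-1` B) `*` (T2 @^-1` C)) //.
  rewrite product_measure1E//; last 2 first.
    by rewrite -[X in measurable X]setTI; exact: mT1.
    by rewrite -[X in measurable X]setTI; exact: mT2.
  congr (_ * _)%E; first exact: lebesgue_reflect.
  exact: IH.
  by rewrite -[X in measurable X]setTI; exact: measurable_rV_cons.
rewrite /m'/= /pushforward; congr (product_measure1 _ _ _).
have TE p : a *+ 2 - rV_cons p = rV_cons (T p).
  apply/rowP => i; rewrite reflectE; case: (unliftP ord0 i) => [j ->|->].
    by rewrite !rV_consS /= reflectE mxE.
  by rewrite !rV_cons0.
by apply/seteqP; split => p /=; rewrite TE.
Qed.

Lemma lebesgue_rV_setT n : (0 < lebesgue_rV n [set: 'rV[R]_n])%E.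
Proof.
have := @lebesgue_rV_box R n (fun=> `[0, 1]%classic) (fun=> measurable_itv _).
under eq_bigr do rewrite /= lebesgue_measure_itv/= lte01 oppr0 adde0.
rewrite big1// => H; apply: (@lt_le_trans _ _ 1%E) => //.
rewrite -H le_measure ?inE//.
rewrite (_ : [set x : 'rV[R]_n | _] = \bigcap_(i in [set: 'I_n])
    ((fun x : 'rV[R]_n => x ord0 i : measurableTypeR R) @^-1` `[0, 1])).
  apply: fin_bigcap_measurable => // i _; rewrite -[X in measurable X]setTI.
  by apply: measurable_coord.
by apply/seteqP; split => x /= K i; [move=> _|]; exact: K.
Qed.

(** [D] and its mirror image in [a] are both null and cannot cover a space of positive measure. Thus
    [a] is the midpoint of two points outside [D]. *)
Lemma negligible_reflect n (a : 'rV[R]_n) (D : set 'rV[R]_n) :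
  (lebesgue_rV n).-negligible D ->
  exists2 y, ~ D y & ~ D (a *+ 2 - y).
Proof.
move=> [N [mN N0 DN]]; apply: contrapT => H.
suff : (0 < lebesgue_rV n (N `|` (fun y => (a *+ 2 - y)%R) @^-1` N))%E.
  have mN' : measurable ((fun y => (a *+ 2 - y)%R) @^-1` N).
    by rewrite -[X in measurable X]setTI; exact: measurable_reflect.
  have : (lebesgue_rV n (N `|` (fun y => (a *+ 2 - y)%R) @^-1` N) <=
      lebesgue_rV n N + lebesgue_rV n ((fun y => (a *+ 2 - y)%R) @^-1` N))%E.
    exact: measureU2.
  rewrite lebesgue_rV_reflect// [X in (_ <= X + X)%E]N0 adde0.
  by rewrite leNgt => /negP.
rewrite (_ : _ `|` _ = setT) ?lebesgue_rV_setT//.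
apply/seteqP; split => // y _; apply: contrapT => /not_orP[h1 h2].
by apply: H; exists y; [move/DN|move/DN].
Qed.

End reflection.

(** * Quadratic cost and lower envelopes *)

Section cost_geometry.
Context {R : realType} {d : nat}.
Notation Rd := 'rV[R]_d.
Notation leb := (@lebesgue_rV R d).

Lemma sqnorm_ge0 (x : Rd) : 0 <= sqnorm x.
Proof. by apply: sumr_ge0 => i _; exact: sqr_ge0. Qed.

Lemma measurable_sqnorm : measurable_fun [set: Rd] (@sqnorm R d).
Proof.
apply: measurable_sum => i; apply: measurable_funX; exact: measurable_coord.
Qed.

Lemma sqnormB_le (x y : Rd) : sqnorm (x - y) <= 2 * (sqnorm x + sqnorm y).
Proof.
rewrite /sqnorm -big_split mulr_sumr; apply: ler_sum => i _.
rewrite /= !mxE; set a := x ord0 i; set b := y ord0 i.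
by have := sqr_ge0 (a + b); rewrite !expr2; lra.
Qed.

Lemma continuous_sqnorm (x0 : Rd) (e : R) : 0 < e ->
  exists2 t, 0 < t & forall x : Rd, (forall i, `|x ord0 i - x0 ord0 i| < t) ->
    `|sqnorm x - sqnorm x0| < e.
Proof.
move=> e0; pose C := \sum_(i < d) (1 + 2 * `|x0 ord0 i|).
have C0 : 0 <= C by apply: sumr_ge0 => i _; rewrite addr_ge0// mulr_ge0.
have C1 : 0 < C + 1 by rewrite ltr_wpDl.
exists (Num.min 1 (e / (C + 1))); first by rewrite lt_min ltr01 divr_gt0.
move=> x H; apply: (@le_lt_trans _ _ (C * (e / (C + 1)))); last first.
  by rewrite mulrCA gtr_pMr// ltr_pdivrMr// mul1r ltrDl.
rewrite /sqnorm -sumrB (le_trans (ler_norm_sum _ _ _))// mulr_suml.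
apply: ler_sum => i _; have := H i; rewrite lt_min => /andP[h1 h2].
set a := x ord0 i in h1 h2 *; set b := x0 ord0 i in h1 h2 *.
rewrite (_ : a ^+ 2 - b ^+ 2 = (a - b + 2 * b) * (a - b)); last by ring.
rewrite normrM ler_pM//; last exact: ltW.
by rewrite (le_trans (ler_normD _ _))// normrM ger0_norm ?lerD2r// ltW.
Qed.

Section tau.
Variable tau : R.
Hypothesis tau_gt0 : 0 < tau.

Local Notation c := (@cost R d tau).

Lemma cost_ge0 (x y : Rd) : 0 <= c x y.
Proof. by rewrite divr_ge0 ?sqnorm_ge0// mulr_ge0// ltW. Qed.

Lemma costC (x y : Rd) : c x y = c y x.
Proof.
by congr (_ / _); apply: eq_bigr => i _; rewrite !mxE; ring.
Qed.

Lemma cost_le (x y : Rd) : c x y <= (sqnorm x + sqnorm y) / tau.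
Proof.
rewrite /cost ler_pdivrMr ?mulr_gt0//.
rewrite mulrCA divfK ?gt_eqF// mulrC.
by rewrite (le_trans (sqnormB_le _ _))// mulrC.
Qed.

Lemma measurable_cost : measurable_fun [set: Rd * Rd] (fun p => c p.1 p.2).
Proof.
apply: measurable_funM => //; apply: measurable_sum => i.
apply: measurable_funX; under eq_fun do rewrite !mxE.
by apply: measurable_funB; apply: (measurableT_comp (measurable_coord i)).
Qed.

Lemma continuous_cost (x0 y0 : Rd) (e : R) : 0 < e ->
  exists2 t, 0 < t & forall x y : Rd,
    (forall i, `|x ord0 i - x0 ord0 i| < t) ->
    (forall i, `|y ord0 i - y0 ord0 i| < t) -> `|c x y - c x0 y0| < e.
Proof.
move=> e0; have e0' : 0 < e * (2 * tau) by rewrite !mulr_gt0.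
have [t t0 H] := continuous_sqnorm (x0 - y0) e0'.
exists (t / 2) => [|x y hx hy]; first by rewrite divr_gt0.
rewrite -mulrBl normrM [X in _ * X]gtr0_norm ?invr_gt0 ?mulr_gt0//.
rewrite ltr_pdivrMr ?mulr_gt0//; apply: H => i; rewrite !mxE.
rewrite (_ : _ - _ - _ = (x ord0 i - x0 ord0 i) - (y ord0 i - y0 ord0 i));
  last by ring.
by rewrite (le_lt_trans (ler_normB _ _))// (splitr t) ltrD.
Qed.

(** The parallelogram identity. The defect [sqnorm (y - a) / (2 * tau)] does not depend on [x], so
    it is the same for all members of a family of costs. *)
Lemma cost_midpoint (x a y : Rd) :
  c x a = (c x y + c x (a *+ 2 - y)) / 2 - sqnorm (y - a) / (2 * tau).
Proof.
rewrite /cost -mulrDl mulrAC -mulrBl; congr (_ / _).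
rewrite /sqnorm -big_split/= mulr_suml -sumrB; apply: eq_bigr => i _.
by rewrite !mxE -mulr2n; field.
Qed.

(* Each [y |-> c x y - b] is a common quadratic minus an affine function, so
   being bounded below at [y] is a midpoint-convex condition on [y]. *)
Lemma bounded_below_everywhere (J : Type) (P : set J) (xs : J -> Rd)
    (b : J -> R) :
  leb.-negligible
    (~` [set y | exists M, forall p, P p -> M <= c (xs p) y - b p]) ->
  forall y, exists M, forall p, P p -> M <= c (xs p) y - b p.
Proof.
move=> nD a; have [y] := negligible_reflect a nD.
move=> /contrapT[M1 H1] /contrapT[M2 H2].
exists ((M1 + M2) / 2 - sqnorm (y - a) / (2 * tau)) => p Pp.
rewrite (cost_midpoint _ a y).
by have := H1 p Pp; have := H2 p Pp; lra.
Qed.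

(** [phi] is the pointwise infimum of the family, characterised as a lower bound that is approached.
    This form includes finiteness, and it expresses [c]-concavity and the [c]-transform alike. *)
Definition lower_envelope (J : Type) (P : set J) (xs : J -> Rd) (b : J -> R)
    (phi : Rd -> R) :=
  (forall p y, P p -> phi y <= c (xs p) y - b p) /\
  (forall y e, 0 < e -> exists2 p, P p & c (xs p) y - b p < phi y + e).

Lemma lower_envelope_exists (J : Type) (P : set J) (xs : J -> Rd)
    (b : J -> R) :
  P !=set0 ->
  (forall y, exists M, forall p, P p -> M <= c (xs p) y - b p) ->
  exists phi, lower_envelope P xs b phi.
Proof.
move=> [p0 Pp0] H; pose S y := [set c (xs p) y - b p | p in P].
have Slb y : has_lbound (S y).
  by have [M HM] := H y; exists M => _ [p Pp <-]; exact: HM.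
have S0 y : S y !=set0 by exists (c (xs p0) y - b p0); exists p0.
exists (fun y => inf (S y)); split => [p y Pp|y e e0].
  by apply: ge_inf => //; exists p.
have [|_ [p Pp <-] h] := @inf_adherent _ (S y) e e0; first by split.
by exists p.
Qed.

Lemma c_concaveP (phi : Rd -> R) :
  c_concave tau phi <-> exists eta, lower_envelope setT id eta phi.
Proof.
split=> -[eta H]; exists eta.
  split=> [x y _|y e e0].
    by rewrite -lee_fin H ereal_inf_lbound//; exists x.
  have : (ereal_inf [set (c x y - eta x)%:E | x in setT] < (phi y + e)%:E)%E.
    by rewrite -H lte_fin ltrDl.
  by move=> /ereal_inf_lt[_ [x _ <-]]; rewrite lte_fin => h; exists x.
move=> y; apply/eqP; rewrite eq_le; apply/andP; split.
  by apply: le_ereal_inf_tmp => _ [x _ <-]; rewrite lee_fin; exact: H.1.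
apply/lee_addgt0Pr => e e0; have [x _ h] := H.2 y e e0.
apply: ge_ereal_inf; exists (c x y - eta x)%:E; first by exists x.
by rewrite -EFinD lee_fin ltW.
Qed.

Lemma c_transformE (phi psi : Rd -> R) :
  lower_envelope setT id phi psi ->
  forall x, c_transform tau phi x = (psi x)%:E.
Proof.
move=> H x; apply/eqP; rewrite eq_le; apply/andP; split; last first.
  by apply: le_ereal_inf_tmp => _ [y _ <-]; rewrite lee_fin costC; exact: H.1.
apply/lee_addgt0Pr => e e0; have [y _ h] := H.2 x e e0.
apply: ge_ereal_inf; exists (c x y - phi y)%:E; first by exists y.
by rewrite -EFinD lee_fin costC ltW.
Qed.

(** The transform is finite: the function [eta] that generates [phi] bounds [c x y - phi y] from
    below at each [x]. *)
Lemma c_concave_transform (phi : Rd -> R) : c_concave tau phi ->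
  exists psi, lower_envelope setT id phi psi.
Proof.
move=> /c_concaveP[eta [H _]].
apply: lower_envelope_exists; first by exists 0.
by move=> x; exists (eta x) => y _; have := H x y I; rewrite costC/=; lra.
Qed.

(** The transform [psi] of [phi] serves as weight. It dominates [b p] at [xs p], so the envelope of
    [psi] over all points lies below that of [b], and by definition of the transform it does not go
    below [phi]. *)
Lemma c_concave_envelope (J : Type) (P : set J) (xs : J -> Rd) (b : J -> R)
    (phi psi : Rd -> R) :
  lower_envelope P xs b phi -> lower_envelope setT id phi psi ->
  c_concave tau phi.
Proof.
move=> [H1 H2] [K1 K2]; apply/c_concaveP; exists psi; split=> [x y _|y e e0].
  by have := K1 y x I; rewrite costC/=; lra.
have [p Pp h] := H2 y e e0; exists (xs p) => //=.
suff : b p <= psi (xs p) by lra.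
rewrite leNgt; apply/negP; rewrite -subr_gt0 => /(K2 (xs p))[z _].
by rewrite costC/= => h'; have := H1 p z Pp; lra.
Qed.

(** An infimum of continuous functions is upper semicontinuous: the sets [phi < a] are open, even
    when the family is uncountable. *)
Lemma measurable_envelope (J : Type) (P : set J) (xs : J -> Rd) (b : J -> R)
    (phi : Rd -> R) :
  lower_envelope P xs b phi -> measurable_fun [set: Rd] phi.
Proof.
move=> [H1 H2]; apply: (measurability _ (RGenInftyO.measurableE R)) => //.
move=> /= _ [_ [a ->] <-]; rewrite setTI; apply: sub_sigma_algebra => /=.
rewrite openE => y /=; rewrite in_itv/= => phiy.
have e0 : 0 < a - phi y by rewrite subr_gt0.
have [p Pp h] := H2 y _ e0; rewrite subrKC in h.
have e1 : 0 < a - (c (xs p) y - b p) by rewrite subr_gt0.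
have [t t0 Ht] := continuous_cost (xs p) y e1.
apply/nbhs_ballP; exists t => //= z [_ yz]; rewrite /preimage/= in_itv/=.
apply: (le_lt_trans (H1 p z Pp)).
suff : `|c (xs p) z - c (xs p) y| < a - (c (xs p) y - b p).
  by rewrite ltr_distl => /andP[_]; lra.
apply: Ht => i; first by rewrite subrr normr0.
by rewrite distrC; have := yz ord0 i.
Qed.

Lemma c_concave_measurable (phi : Rd -> R) :
  c_concave tau phi -> measurable_fun [set: Rd] phi.
Proof. by move=> /c_concaveP[eta]; exact: measurable_envelope. Qed.

(** The member of the family at the point 0 gives a bound of quadratic growth, integrable under
    finite second moments. In general there is no lower bound of this kind. *)
Lemma envelope_ub (eta phi : Rd -> R) : lower_envelope setT id eta phi ->
  forall y, phi y <= sqnorm y / tau + `|eta 0|.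
Proof.
move=> [H _] y; apply: (le_trans (H 0 y I)) => /=.
have := cost_le 0 y; have := ler_norm (- eta 0); rewrite normrN.
suff -> : sqnorm (0 : Rd) = 0 by rewrite add0r; lra.
by rewrite /sqnorm big1// => i _; rewrite mxE expr0n.
Qed.

Lemma c_superdiffE (phi psi : Rd -> R) : lower_envelope setT id phi psi ->
  c_superdiff tau phi = [set p | psi p.1 + phi p.2 = c p.1 p.2].
Proof.
move=> H; apply/seteqP; split=> p /=; rewrite /c_superdiff/= (c_transformE H).
  by rewrite -EFinD => -[].
by move=> <-.
Qed.

Lemma lower_envelope_shift (phi psi : Rd -> R) (b : R) :
  lower_envelope setT id phi psi ->
  lower_envelope setT id (fun y => phi y - b) (fun x => psi x + b).
Proof.
move=> [H1 H2]; split=> [x y _|y e e0]; first by have := H1 x y I; lra.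
by have [x _ h] := H2 y e e0; exists x => //; lra.
Qed.

Lemma c_concave_shift (phi : Rd -> R) (b : R) : c_concave tau phi ->
  c_concave tau (fun y => phi y - b) /\
  c_superdiff tau (fun y => phi y - b) = c_superdiff tau phi.
Proof.
move=> cphi; have [psi Hpsi] := c_concave_transform cphi; split.
  have /c_concaveP[eta Heta] := cphi.
  apply/c_concaveP; exists (fun x => eta x - (- b)).
  exact: (lower_envelope_shift (- b) Heta).
rewrite (c_superdiffE Hpsi) (c_superdiffE (lower_envelope_shift b Hpsi)).
by apply/seteqP; split=> p /=; lra.
Qed.

End tau.
End cost_geometry.

(** * Shortest paths in a directed graph without negative cycles *)

Section shortest_path.
Context (R : realType) (T : Type) (Gam : set T).
Variables (adj : T -> T -> Prop) (w : T -> T -> R).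

Fixpoint walk (p : T) (s : seq T) : Prop :=
  if s is q :: s' then [/\ Gam q, adj p q & walk q s'] else True.

Fixpoint walk_weight (p : T) (s : seq T) : R :=
  if s is q :: s' then w p q + walk_weight q s' else 0.

Lemma walk_cat p s1 s2 :
  walk p s1 -> walk (last p s1) s2 -> walk p (s1 ++ s2).
Proof. by elim: s1 p => [//|q s IH] p /= [? ? ?] ?; split => //; exact: IH. Qed.

Lemma walk_weight_cat p s1 s2 :
  walk_weight p (s1 ++ s2) = walk_weight p s1 + walk_weight (last p s1) s2.
Proof. by elim: s1 p => [|q s IH] p /=; rewrite ?add0r// IH addrA. Qed.

Hypothesis no_negative_cycle : forall p s, Gam p -> walk p s -> last p s = p ->
  0 <= walk_weight p s.
Hypothesis connected_walk : forall p q, Gam p -> Gam q ->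
  exists2 s, walk p s & last p s = q.

(** [D q] is the infimum of the weights of walks from a base point [p0] to [q]. A fixed walk back
    from [q] to [p0] closes each of them into a cycle, which bounds the infimum from below;
    appending the edge from [p] to [q] gives the inequality. *)
Lemma shortest_path_potential : exists D : T -> R,
  forall p q, Gam p -> Gam q -> adj p q -> D q <= D p + w p q.
Proof.
have [[p0 Gp0]|G0] := pselect (Gam !=set0); last first.
  by exists (fun=> 0) => p q Gp; exfalso; apply: G0; exists p.
pose S q := [set walk_weight p0 s | s in [set s | walk p0 s /\ last p0 s = q]].
have Slb q : Gam q -> has_lbound (S q).
  move=> Gq; have [s' ws' ls'] := connected_walk Gq Gp0.
  exists (- walk_weight q s') => _ [s [ws ls] <-].
  rewrite -subr_ge0 opprK -{1}ls -walk_weight_cat.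
  apply: no_negative_cycle => //; first by apply: walk_cat => //; rewrite ls.
  by rewrite last_cat ls.
have S0 q : Gam q -> S q !=set0.
  move=> Gq; have [s ws ls] := connected_walk Gp0 Gq.
  by exists (walk_weight p0 s); exists s.
exists (fun q => inf (S q)) => p q Gp Gq apq.
apply/ler_addgt0Pr => e e0.
have [|_ [s [ws ls] <-] h] := @inf_adherent _ (S p) e e0.
  by split; [exact: S0|exact: Slb].
have : inf (S q) <= walk_weight p0 (rcons s q).
  apply: ge_inf; first exact: Slb.
  exists (rcons s q) => //; split; last by rewrite last_rcons.
  by rewrite -cats1; apply: walk_cat => //=; rewrite ls.
by rewrite -cats1 walk_weight_cat/= ls addr0; lra.
Qed.

(** Together with [walk_nth], this passes from recursive walks to the indexed cycles for which the
    first variation is computed. *)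
Lemma walk_weight_sum p s : walk_weight p s =
  \sum_(i < size s) w (nth p (p :: s) i) (nth p (p :: s) i.+1).
Proof.
elim: s p => [|q s IH] p /=; first by rewrite big_ord0.
rewrite big_ord_recl/= IH; congr (_ + _); apply: eq_bigr => i _ /=.
congr (w _ _); last exact/set_nth_default.
case: i => -[|i] //= hi; apply: set_nth_default; exact: ltnW.
Qed.

Lemma walk_nth p s : Gam p -> walk p s ->
  (forall i, (i <= size s)%N -> Gam (nth p (p :: s) i)) /\
  (forall i, (i < size s)%N -> adj (nth p (p :: s) i) (nth p (p :: s) i.+1)).
Proof.
elim: s p => [|q s IH] p Gp /=; first by split => // -[|].
move=> [Gq apq /(IH _ Gq)[h1 h2]]; split=> -[|i] //= hi.
  by have := h1 i hi; rewrite (@set_nth_default _ (q :: s) p q).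
have := h2 i hi; rewrite /= (@set_nth_default _ s p q)//.
by rewrite (@set_nth_default _ (q :: s) p q)//= ltnW.
Qed.

End shortest_path.

(** * Orthogonality to balanced perturbations *)

Section measure_tools.
Context d (T : measurableType d) (R : realType).
Variable m : {measure set T -> \bar R}.

Lemma ae_forall_fin (J : finType) (P : J -> T -> Prop) :
  (forall j, {ae m, forall x, P j x}) -> {ae m, forall x j, P j x}.
Proof.
move=> H; pose Q n x := if unpickle n is Some j then P j x else True.
have : {ae m, forall x n, Q n x}.
  apply: ae_foralln => n; rewrite /Q.
  case: (unpickle n) => [j|]; first exact: H.
  exact/aeW.
by apply: filterS => x Hx j; have := Hx (pickle j); rewrite /Q pickleK.
Qed.

Lemma integrable_indicM (A : set T) (k : R) : measurable A -> (m A < +oo)%E ->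
  m.-integrable setT (fun x => (k * \1_A x)%:E).
Proof.
move=> mA mAoo; apply/integrableP; split.
  by apply/measurable_EFinP; apply: measurable_funM.
under eq_integral do rewrite /= normrM EFinM [`|\1_A _|]ger0_norm//.
rewrite ge0_integralZl_EFin//.
  by rewrite integral_indic// setIT lte_mul_pinfty.
by apply/measurable_EFinP; exact: measurable_indic.
Qed.

Lemma restrict_indicM (A : set T) (f : T -> R) :
  (EFin \o f) \_ A = (fun x => (f x * \1_A x)%:E).
Proof.
by apply/funext => x; rewrite /patch indicE; case: ifPn;
  rewrite /= ?mulr1 ?mulr0.
Qed.

Lemma integrable_restrictM (A : set T) (f : T -> R) : measurable A ->
  m.-integrable A (EFin \o f) ->
  m.-integrable setT (fun x => (f x * \1_A x)%:E).
Proof. by move=> mA /(integrable_mkcond _ mA); rewrite restrict_indicM. Qed.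

Lemma integral_restrictM (A : set T) (f : T -> R) :
  (\int[m]_(x in A) (f x)%:E = \int[m]_x (f x * \1_A x)%:E)%E.
Proof. by rewrite integral_mkcond restrict_indicM. Qed.

Lemma integrable_le (f g : T -> R) :
  measurable_fun setT f -> (forall x, `|f x| <= g x) ->
  m.-integrable setT (EFin \o g) -> m.-integrable setT (EFin \o f).
Proof.
move=> mf fg; apply: le_integrable => //; first exact/measurable_EFinP.
by move=> x _ /=; rewrite lee_fin (le_trans (fg x))// ler_norm.
Qed.

End measure_tools.

Section boxes.
Context {R : realType} {d : nat}.
Notation Rd := 'rV[R]_d.
Notation leb := (@lebesgue_rV R d).

Definition cube (n : nat) : set Rd :=
  [set x | forall i, x ord0 i \in `[- n%:R, n%:R]].

Lemma measurable_cube n : measurable (cube n).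
Proof.
rewrite (_ : cube n = \bigcap_(i in [set: 'I_d])
    ((fun x : Rd => x ord0 i : measurableTypeR R) @^-1` `[- n%:R, n%:R])).
  apply: fin_bigcap_measurable => // i _; rewrite -[X in measurable X]setTI.
  by apply: measurable_coord.
by apply/seteqP; split => x /= K i; [move=> _|]; exact: K.
Qed.

Lemma compact_cube n : compact (cube n).
Proof.
apply: (@rV_compact R d (fun=> `[- n%:R, n%:R]%classic)) => i.
exact: segment_compact.
Qed.

Lemma lebesgue_cube n : leb (cube n) = ((2 * n%:R) ^+ d)%:E.
Proof.
rewrite (@lebesgue_rV_box R d (fun=> `[- n%:R, n%:R]%classic)); last first.
  by move=> i; exact: measurable_itv.
rewrite (eq_bigr (fun=> (2 * n%:R)%:E)) => [|i _]; last first.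
  rewrite /= lebesgue_measure_itv/= lte_fin.
  case: ltP => [_|]; first by rewrite -EFinB; congr EFin; ring.
  by move=> h; congr EFin; have := ler0n R n; lra.
by rewrite prodEFin prodr_const card_ord.
Qed.

Lemma lebesgue_cube_lty n : (leb (cube n) < +oo)%E.
Proof. by rewrite lebesgue_cube ltry. Qed.

Lemma lebesgue_sub_cube_lty (A : set Rd) n : measurable A -> A `<=` cube n ->
  (leb A < +oo)%E.
Proof.
move=> mA An; apply: le_lt_trans (lebesgue_cube_lty n).
by apply: le_measure; rewrite ?inE//; exact: measurable_cube.
Qed.

Lemma bigcup_cube : \bigcup_n cube n = setT.
Proof.
apply/seteqP; split => // x _; pose M := \sum_i `|x ord0 i|.
exists (Num.bound M) => // i; rewrite in_itv/= -ler_norml.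
apply: le_trans (ltW (archi_boundP _)); last exact: sumr_ge0.
by rewrite /M (bigD1 i)//= lerDl sumr_ge0.
Qed.

Lemma L2loc_integrable_cube (f : Rd -> R) n : L2loc f ->
  leb.-integrable (cube n) (EFin \o f).
Proof.
move=> [mf f2]; apply: (@le_integrable _ _ _ _ _ (measurable_cube n) _
    (fun x => (f x ^+ 2 + 1)%:E)).
- by apply/measurable_EFinP; exact: measurable_funTS.
- move=> x _; rewrite /= lee_fin [leRHS]ger0_norm ?addr_ge0 ?sqr_ge0//.
  rewrite -real_normK ?num_real//; set a := `|f x|.
  by have := sqr_ge0 (a - 1); have := sqr_ge0 a; rewrite !expr2; lra.
- apply: (@integrableD _ _ _ _ _ (measurable_cube n)
    (fun x => (f x ^+ 2)%:E) (EFin \o cst 1)).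
    apply/integrableP; split.
      apply/measurable_EFinP/measurable_funTS; exact: measurable_funX.
    under eq_integral do rewrite gee0_abs ?lee_fin ?sqr_ge0//.
    by apply: f2; exact: compact_cube.
  apply: measurable_bounded_integrable => //; first exact: measurable_cube.
    exact: lebesgue_cube_lty.
  exact: bounded_cst.
Qed.

Lemma L2locB (f g : Rd -> R) : L2loc f -> L2loc g ->
  L2loc (fun x => f x - g x).
Proof.
move=> [mf f2] [mg g2]; split => [|A cA]; first exact: measurable_funB.
have mA : measurable A.
  by rewrite -(setCK A); apply: measurableC; apply: sub_sigma_algebra;
     rewrite /= openC; apply: compact_closed.
have msq (u : Rd -> R) : measurable_fun setT u ->
    measurable_fun A (fun x => (u x ^+ 2)%:E).
  by move=> mu; apply/measurable_EFinP/measurable_funTS; exact: measurable_funX.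
apply: (@le_lt_trans _ _ (\int[leb]_(x in A) (2%:E * (f x ^+ 2)%:E +
   2%:E * (g x ^+ 2)%:E)%E)%E).
  apply: ge0_le_integral => //.
  - by move=> x _; rewrite lee_fin sqr_ge0.
  - by apply: msq; exact: measurable_funB.
  - by apply: emeasurable_funD; apply: emeasurable_funM => //; exact: msq.
  - move=> x _; rewrite -!EFinM -EFinD lee_fin.
    by have := sqr_ge0 (f x + g x); rewrite !expr2; lra.
rewrite ge0_integralD//; last 4 first.
- by move=> x _; rewrite -EFinM lee_fin mulr_ge0// sqr_ge0.
- by apply: emeasurable_funM => //; exact: msq.
- by move=> x _; rewrite -EFinM lee_fin mulr_ge0// sqr_ge0.
- by apply: emeasurable_funM => //; exact: msq.
rewrite !ge0_integralZl_EFin//; last 4 first.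
- by move=> x _; rewrite lee_fin sqr_ge0.
- exact: msq.
- by move=> x _; rewrite lee_fin sqr_ge0.
- exact: msq.
by apply: lte_add_pinfty; rewrite lte_mul_pinfty//; [exact: f2|exact: g2].
Qed.

(* Testing against multiples of [1_A - (|A|/|B|) 1_B] forces all averages of
   [f] over bounded sets to coincide. *)
Lemma L2loc_ae_const (f : Rd -> R) : L2loc f ->
  (forall u : Rd -> R, measurable_fun setT u ->
     (exists n (M : R), forall x, `|u x| <= M * \1_(cube n) x) ->
     (\int[leb]_x (u x)%:E = 0)%E -> (\int[leb]_x (f x * u x)%:E = 0)%E) ->
  exists b, {ae leb, forall x, f x = b}.
Proof.
move=> f2 H; pose a := fine (leb (cube 1)).
have mcube := measurable_cube.
have a0 : 0 < a by rewrite /a lebesgue_cube/= mulr1 exprn_gt0.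
have leblty := @lebesgue_sub_cube_lty.
have lebE (A : set Rd) n : measurable A -> A `<=` cube n ->
    leb A = (fine (leb A))%:E.
  by move=> mA An; rewrite fineK// ge0_fin_numE//; exact: (leblty _ n).
have fi n (A : set Rd) : measurable A -> A `<=` cube n ->
    leb.-integrable A (EFin \o f).
  by move=> mA An; apply: integrableS (L2loc_integrable_cube n f2).
pose b := fine (\int[leb]_(x in cube 1) (f x)%:E) / a.
exists b; suff Hn n : {ae leb, forall x, cube n x -> f x = b}.
  apply: filterS (ae_foralln Hn) => x Hx.
  have [n _ xn] : (\bigcup_n cube n) x by rewrite bigcup_cube.
  exact: (Hx n).
suff: ae_eq leb (cube n) (EFin \o f) (EFin \o cst b).
  by apply: filterS => x /= H' xn; have [] := H' xn.
apply: (integral_ae_eq (mcube n)) => //.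
- exact: L2loc_integrable_cube.
- exact/measurable_EFinP.
move=> A An mA; pose N := maxn 1 n.
have cubeS k l : (k <= l)%N -> cube k `<=` cube l.
  move=> kl x xk i; have := xk i; rewrite !in_itv/=.
  have : (k%:R : R) <= l%:R by rewrite ler_nat.
  by move=> ?; lra.
have AN : A `<=` cube N.
  by apply: (subset_trans An); apply: cubeS; exact: leq_maxr.
have BN : cube 1 `<=` cube N by apply: cubeS; exact: leq_maxl.
pose al := fine (leb A).
pose u x : R := a * \1_A x - al * \1_(cube 1) x.
have iu1 : leb.-integrable setT (fun x => (a * \1_A x)%:E).
  by apply: integrable_indicM => //; exact: (leblty _ N).
have iu2 : leb.-integrable setT (fun x => (al * \1_(cube 1) x)%:E).
  by apply: integrable_indicM => //; exact: (leblty _ N).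
have mind (B : set Rd) : measurable B -> measurable_fun setT (\1_B : Rd -> R).
  by move=> mB; exact: measurable_indic.
have intind (k : R) (B : set Rd) : measurable B -> B `<=` cube N -> 0 <= k ->
    (\int[leb]_x (k * \1_B x)%:E)%E = (k * fine (leb B))%:E.
  move=> mB BN' k0; under eq_integral do rewrite EFinM.
  rewrite ge0_integralZl_EFin//; last by apply/measurable_EFinP; exact: mind.
  rewrite EFinM -(lebE B N)//; congr (_ * _)%E.
  by rewrite integral_indic// setIT.
have al0 : 0 <= al by rewrite fine_ge0.
have : (\int[leb]_x (f x * u x)%:E = 0)%E.
  apply: H.
  - by apply: measurable_funB; apply: measurable_funM => //; exact: mind.
  - exists N, (a + al) => x; rewrite /u !indicE.
    have [xN|xN] := boolP (x \in cube N).
      rewrite mulr1 (le_trans (ler_normB _ _))// !normrM !(ger0_norm (ltW a0)).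
      have n1 (c : bool) : `|c%:R : R| <= 1 by case: c; rewrite ?normr0 ?normr1.
      by rewrite (ger0_norm al0) lerD// ler_piMr// ltW.
    have xN' : ~ cube N x by move=> K; move/negP: xN; apply; rewrite inE.
    by rewrite !memNset ?mulr0 ?subrr ?normr0// => [/BN|/AN].
  - rewrite integralB_EFin// !intind// ?ltW//.
    by rewrite -EFinB mulrC subrr.
have ifA (B : set Rd) (k : R) : measurable B -> B `<=` cube N ->
    leb.-integrable setT (fun x => (k * (f x * \1_B x))%:E).
  move=> mB BN'; under eq_fun do rewrite EFinM.
  apply: integrableZl => //.
  by apply: integrable_restrictM => //; exact: (fi N).
have intfA (B : set Rd) (k : R) : measurable B -> B `<=` cube N ->
    (\int[leb]_x (k * (f x * \1_B x))%:E =
     k%:E * \int[leb]_(x in B) (f x)%:E)%E.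
  move=> mB BN'; rewrite (integral_restrictM _ B) -integralZl//.
  by apply: integrable_restrictM => //; exact: (fi N).
have -> : (\int[leb]_x (f x * u x)%:E = \int[leb]_x
    (a * (f x * \1_A x) - al * (f x * \1_(cube 1) x))%:E)%E.
  by apply: eq_integral => x _; rewrite /u; congr EFin; ring.
rewrite integralB_EFin//; [|exact: ifA..].
rewrite !intfA//.
have finA (B : set Rd) : measurable B -> B `<=` cube N ->
    (\int[leb]_(x in B) (f x)%:E)%E \is a fin_num.
  by move=> mB BN'; apply: integrable_fin_num => //; exact: (fi N).
rewrite -(fineK (finA _ mA AN)) -(fineK (finA _ (mcube 1%N) BN)).
rewrite -!EFinM -EFinB => -[E].
transitivity (b * al)%:E; last first.
  rewrite EFinM -(lebE A N)//; apply/esym; exact: (integral_cst leb mA b%:E).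
congr EFin; apply: (mulfI (lt0r_neq0 a0)); rewrite /b.
by rewrite mulrA mulrCA divff ?gt_eqF// mulr1; lra.
Qed.

(** The perturbation equal to [u] on layer [g] and to [- u] on layer [g0] is balanced over the
    layers, and it lies in [Phi] when [u] is bounded with zero integral and vanishes outside a cube.
    Tested against it, [chi] is seen only through [chi g - chi g0]. *)
Lemma Phi_orth_ae_const (G : finType) (chi : G -> Rd -> R) :
  Phi_orth chi ->
  forall g g0, exists b, {ae leb, forall x, chi g x - chi g0 x = b}.
Proof.
move=> [chi2 orth] g g0; have [->|gg0] := eqVneq g g0.
  by exists 0; apply/aeW => x; rewrite subrr.
apply: L2loc_ae_const; first exact: L2locB.
move=> u mu [n [M uM]] u0.
pose eps g' x : R := ((g' == g)%:R - (g' == g0)%:R) * u x.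
have mcube := measurable_cube.
have chiu x : \sum_g' chi g' x * eps g' x = (chi g x - chi g0 x) * u x.
  rewrite (bigD1 g)//= (bigD1 g0)/=; last by rewrite eq_sym.
  rewrite big1 => [|g' /andP[/negbTE h1 /negbTE h2]].
    rewrite /eps !eqxx (negbTE gg0) (eq_sym g0 g) (negbTE gg0) /=.
    by rewrite subr0 sub0r; ring.
  by rewrite /eps h1 h2 subrr mul0r mulr0.
under eq_integral do rewrite -chiu.
apply: orth; have M0 x : cube n x -> 0 <= M.
  by move=> xn; have := uM x; rewrite indicE mem_set// mulr1; apply: le_trans.
have epsM g' x : `|eps g' x| <= M * \1_(cube n) x.
  rewrite (le_trans _ (uM x))// normrM ler_piMl//.
  by case: (g' == g); case: (g' == g0);
     rewrite ?(subrr, subr0, sub0r, normrN, normr1, normr0).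
have meps g' : measurable_fun setT (eps g') by exact: measurable_funM.
split.
- move=> g'; rewrite inE; apply/andP; split; rewrite inE/=; first exact: meps.
  rewrite /finite_norm unlock/= poweR_lty//.
  apply: (@le_lt_trans _ _ (\int[leb]_x ((M ^+ 2) * \1_(cube n) x)%:E)%E).
    apply: ge0_le_integral => //.
    + apply/measurable_EFinP; apply: (measurableT_comp (measurable_powR 2)).
      exact: measurableT_comp.
    + by apply/measurable_EFinP; apply: measurable_funM => //;
        exact: measurable_indic.
    + move=> x _; rewrite lee_fin powR_mulrn//.
      rewrite (le_trans (_ : _ <= (M * \1_(cube n) x) ^+ 2))//.
        by rewrite lerXn2r// nnegrE// (le_trans _ (epsM g' x)).
      by rewrite exprMn indicE; case: (_ \in _); rewrite ?expr0n ?expr1n.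
  apply: integrable_lty => //; apply: integrable_indicM => //.
  exact: lebesgue_cube_lty.
- exists (cube n); first exact: compact_cube.
  move=> g'; apply/aeW => x xn; have := epsM g' x.
  by rewrite indicE memNset// mulr0 normr_le0 => /eqP.
- move=> g'; under eq_integral do rewrite EFinM.
  rewrite integralZl// ?u0 ?mule0//.
  apply: (@integrable_le _ _ _ _ _ (fun x => M * \1_(cube n) x)) => //.
  apply: integrable_indicM => //.
  exact: lebesgue_cube_lty.
- apply/aeW => x; rewrite /eps -mulr_suml sumrB.
  have E (k : G) : \sum_(i : G) ((i == k)%:R : R) = 1.
    by rewrite (bigD1 k)//= eqxx big1 ?addr0// => i /negbTE ->.
  by rewrite !E subrr mul0r.
Qed.

End boxes.

(** * Real-valued integrals, densities and marginals *)

Local Notation integrableR m f := (integrable m setT (EFin \o f))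
  (only parsing).

Section real_integrals.
Context d (T : measurableType d) (R : realType).
Variable m : {measure set T -> \bar R}.
Implicit Types f g : T -> R.

Lemma integrableRD f g : integrableR m f -> integrableR m g ->
  integrableR m (fun x => f x + g x).
Proof. by move=> fi gi; apply: (integrableD measurableT fi gi). Qed.

Lemma integrableRB f g : integrableR m f -> integrableR m g ->
  integrableR m (fun x => f x - g x).
Proof. by move=> fi gi; apply: (integrableB measurableT fi gi). Qed.

Lemma integrableRZ (k : R) f : integrableR m f ->
  integrableR m (fun x => k * f x).
Proof. by move=> fi; apply: (integrableZl measurableT k fi). Qed.

Lemma integrableR_norm f : integrableR m f -> integrableR m (fun x => `|f x|).
Proof. exact: integrable_norm. Qed.

Lemma integrableR_sum (J : Type) (s : seq J) (P : pred J) (F : J -> T -> R) :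
  (forall j, P j -> integrableR m (F j)) ->
  integrableR m (fun x => \sum_(j <- s | P j) F j x).
Proof.
move=> Fi; have := integrable_sum measurableT s Fi.
by apply: eq_integrable => // x _; rewrite /= sumEFin.
Qed.

Lemma integrableR_measurable f : integrableR m f -> measurable_fun setT f.
Proof. by move=> /integrableP[/measurable_EFinP]. Qed.

Lemma RintegralE f : integrableR m f ->
  (\int[m]_x (f x)%:E = (\int[m]_x f x)%:E)%E.
Proof. by move=> fi; rewrite fineK//; exact: integrable_fin_num. Qed.

Lemma Rintegral_sum (J : Type) (s : seq J) (F : J -> T -> R) :
  (forall j, integrableR m (F j)) ->
  \int[m]_x (\sum_(j <- s) F j x) = \sum_(j <- s) \int[m]_x F j x.
Proof.
move=> Fi; apply: EFin_inj; rewrite -RintegralE; last exact: integrableR_sum.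
under eq_integral do rewrite -sumEFin.
rewrite integral_sum// -sumEFin; apply: eq_bigr => j _.
by rewrite RintegralE.
Qed.

Lemma integrableR_ae_le f g : measurable_fun setT f ->
  {ae m, forall x, `|f x| <= g x} -> integrableR m g -> integrableR m f.
Proof.
move=> mf fg /integrableP[mg gi]; apply/integrableP; split.
  exact/measurable_EFinP.
apply: le_lt_trans gi; apply: ae_ge0_le_integral => //.
- by apply: measurableT_comp => //; exact/measurable_EFinP.
- exact: measurableT_comp.
- by apply: filterS fg => x fx _ /=; rewrite lee_fin (le_trans fx)// ler_norm.
Qed.

Lemma Rintegral_ae_le f g : integrableR m f -> integrableR m g ->
  {ae m, forall x, f x <= g x} -> \int[m]_x f x <= \int[m]_x g x.
Proof.
move=> fi gi fg; have mf := integrableR_measurable fi.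
have mg := integrableR_measurable gi.
rewrite -subr_ge0 -RintegralB//.
rewrite (_ : Rintegral _ _ _ = \int[m]_x Num.max 0 (g x - f x)).
  by apply: Rintegral_ge0 => x _; rewrite le_max lexx.
congr fine; apply: ae_eq_integral => //.
- by apply/measurable_EFinP; exact: measurable_funB.
- apply/measurable_EFinP; apply: measurable_maxr => //; exact: measurable_funB.
- by apply: filterS fg => x fx _; congr EFin; rewrite max_r// subr_ge0.
Qed.

Lemma Rintegral_ae_eq f g : measurable_fun setT f -> measurable_fun setT g ->
  {ae m, forall x, f x = g x} -> \int[m]_x f x = \int[m]_x g x.
Proof.
move=> mf mg fg; congr fine; apply: ae_eq_integral => //.
- exact/measurable_EFinP.
- exact/measurable_EFinP.
- by apply: filterS fg => x fx _; rewrite fx.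
Qed.

Lemma integrableR_ge0 f : measurable_fun setT f -> (forall x, 0 <= f x) ->
  (\int[m]_x (f x)%:E < +oo)%E -> integrableR m f.
Proof.
move=> mf f0 foo; apply/integrableP; split; first exact/measurable_EFinP.
by under eq_integral do rewrite /= ger0_norm//.
Qed.

End real_integrals.

Section density.
Context d (T : measurableType d) (R : realType).
Variables (m : {sigma_finite_measure set T -> \bar R}).
Variables (nu : {measure set T -> \bar R}) (F : T -> R).
Hypothesis iF : integrableR m F.
Hypothesis nuF : forall A, measurable A -> nu A = (\int[m]_(x in A) (F x)%:E)%E.

Lemma density_dominates : nu `<< m.
Proof.
apply/null_content_dominatesP => A mA mA0; rewrite nuF//.
apply: null_set_integral => //.
exact/measurable_funTS/(measurable_int _ iF).
Qed.

Let nu_fin : (nu setT < +oo)%E.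
Proof. by rewrite nuF// integrable_lty. Qed.

Let nu' : {finite_measure set T -> \bar R} := mfrestr measurableT nu_fin.

Let nu'E A : nu' A = nu A.
Proof. by rewrite /nu'/= /mfrestr /mrestr setIT. Qed.

Let nu'm : nu' `<< m.
Proof.
apply/null_content_dominatesP => A mA mA0; rewrite nu'E.
by have /null_content_dominatesP := density_dominates; apply.
Qed.

Let f := Radon_Nikodym_SigmaFinite.f nu' m.

Let mf : measurable_fun setT f.
Proof. exact: measurable_int (Radon_Nikodym_SigmaFinite.f_integrable nu'm). Qed.

Let fF : ae_eq m setT f (EFin \o F).
Proof.
apply: integral_ae_eq => //.
- exact: Radon_Nikodym_SigmaFinite.f_integrable.
- exact: measurable_int iF.
- move=> A _ mA; rewrite -nuF// -nu'E.
  by rewrite -Radon_Nikodym_SigmaFinite.f_integral.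
Qed.

(** No sign is assumed on [F], which will be a density plus a signed exchange term. It agrees almost
    everywhere with the Radon-Nikodym derivative of [nu], which is nonnegative. *)
Lemma density_ae_ge0 : {ae m, forall x, 0 <= F x}.
Proof.
apply: filterS fF => x /(_ I) /= fx.
by rewrite -lee_fin -fx; exact: Radon_Nikodym_SigmaFinite.f_ge0.
Qed.

Lemma density_integral_ge0 (u : T -> R) : measurable_fun setT u ->
  (forall x, 0 <= u x) ->
  (\int[nu]_x (u x)%:E = \int[m]_x (u x * F x)%:E)%E.
Proof.
move=> mu u0; have mF := integrableR_measurable iF.
rewrite (eq_measure_integral nu'); last by move=> A _ _; exact/esym/nu'E.
rewrite -(Radon_Nikodym_SigmaFinite.change_of_variables nu'm)//;
  last exact/measurable_EFinP.
apply: ae_eq_integral => //.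
- by apply: emeasurable_funM => //; exact/measurable_EFinP.
- by apply/measurable_EFinP; exact: measurable_funM.
- by apply: filterS fF => x /(_ I) fx _; rewrite EFinM; congr (_ * _)%E.
Qed.

Lemma density_integrable (u : T -> R) : measurable_fun setT u ->
  integrableR nu u <-> integrableR m (fun x => u x * F x).
Proof.
move=> mu; have mF := integrableR_measurable iF.
have E : (\int[nu]_x `|u x|%:E = \int[m]_x `|u x * F x|%:E)%E.
  rewrite density_integral_ge0//; last exact: measurableT_comp.
  apply: ae_eq_integral => //.
  - apply/measurable_EFinP; apply: measurable_funM => //.
    exact: measurableT_comp.
  - apply/measurable_EFinP; apply: measurableT_comp => //.
    exact: measurable_funM.
  - apply: filterS density_ae_ge0 => x Fx _.
    by rewrite normrM (ger0_norm Fx).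
split=> /integrableP[_ ui]; apply/integrableP; split.
- by apply/measurable_EFinP; exact: measurable_funM.
- by rewrite -[X in (X < _)%E]E.
- exact/measurable_EFinP.
- by rewrite [X in (X < _)%E]E.
Qed.

Lemma density_integral (u : T -> R) : measurable_fun setT u ->
  integrableR nu u -> \int[nu]_x u x = \int[m]_x (u x * F x).
Proof.
move=> mu ui; have mF := integrableR_measurable iF.
have uFi := (density_integrable mu).1 ui.
pose up x := Num.max 0 (u x); pose un x := Num.max 0 (- u x).
have uE x : u x = up x - un x.
  rewrite /up /un; case: (leP 0 (u x)) => ux.
    by rewrite max_l ?oppr_le0// subr0.
  by rewrite max_r ?oppr_ge0 ?ltW// sub0r opprK.
have mup : measurable_fun setT up by exact: measurable_maxr.
have mun : measurable_fun setT un.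
  by apply: measurable_maxr => //; exact: measurableT_comp.
have up0 x : 0 <= up x by rewrite le_max lexx.
have un0 x : 0 <= un x by rewrite le_max lexx.
have upu x : `|up x| <= `|u x|.
  rewrite (ger0_norm (up0 x)) /up.
  by case: (leP 0 (u x)) => ux; [exact: ler_norm|exact: normr_ge0].
have unu x : `|un x| <= `|u x|.
  rewrite (ger0_norm (un0 x)) /un -normrN.
  by case: (leP 0 (- u x)) => ux; [exact: ler_norm|exact: normr_ge0].
have upi : integrableR nu up.
  exact: (integrable_le mup upu (integrableR_norm ui)).
have uni : integrableR nu un.
  exact: (integrable_le mun unu (integrableR_norm ui)).
under eq_Rintegral do rewrite uE.
rewrite RintegralB//.
transitivity (\int[m]_x (up x * F x - un x * F x)); last first.
  by apply: eq_Rintegral => x _; rewrite uE mulrBl.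
rewrite RintegralB//; [|exact/density_integrable..].
by rewrite /Rintegral !density_integral_ge0.
Qed.

End density.

Section marginals.
Context d1 d2 (X : measurableType d1) (Y : measurableType d2) (R : realType).
Variables (phi : X -> Y) (mphi : measurable_fun setT phi).
Variables (m : {measure set X -> \bar R}) (nu : {measure set Y -> \bar R}).
Hypothesis mnu : forall A, measurable A -> m (phi @^-1` A) = nu A.

Lemma marginal_integral_ge0 (u : Y -> R) : measurable_fun setT u ->
  (forall y, 0 <= u y) -> (\int[m]_x (u (phi x))%:E = \int[nu]_y (u y)%:E)%E.
Proof.
move=> mu u0; pose m' : {measure set Y -> \bar R} :=
  measure_function_pushforward__canonical__measure_function_Measure m mphi.
rewrite [RHS](eq_measure_integral m'); last by move=> A mA _; rewrite -mnu.
rewrite [RHS](@ge0_integral_pushforward _ _ _ _ _ _ mphi m setT (EFin \o u))//.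
  exact/measurable_EFinP.
by move=> y _; rewrite /= lee_fin.
Qed.

Lemma marginal_integrable (u : Y -> R) : measurable_fun setT u ->
  integrableR m (fun x => u (phi x)) <-> integrableR nu u.
Proof.
move=> mu.
have E : (\int[m]_x `|u (phi x)|%:E = \int[nu]_y `|u y|%:E)%E.
  by apply: (@marginal_integral_ge0 (fun y => `|u y|)) => //;
    exact: measurableT_comp.
split=> /integrableP[_ ui]; apply/integrableP; split.
- exact/measurable_EFinP.
- by rewrite -[X in (X < _)%E]E.
- by apply/measurable_EFinP; exact: measurableT_comp.
- by rewrite [X in (X < _)%E]E.
Qed.

Lemma marginal_integral (u : Y -> R) : measurable_fun setT u ->
  integrableR nu u -> \int[m]_x u (phi x) = \int[nu]_y u y.
Proof.
move=> mu ui; have uphi := (marginal_integrable mu).2 ui.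
pose m' : {measure set Y -> \bar R} :=
  measure_function_pushforward__canonical__measure_function_Measure m mphi.
congr fine.
rewrite [RHS](eq_measure_integral m'); last by move=> A mA _; rewrite -mnu.
rewrite (@integral_pushforward _ _ _ _ _ _ mphi m setT (EFin \o u))//.
exact/measurable_EFinP.
Qed.

End marginals.

(** * Admissible pairs *)

Section admissible_pairs.
Context {R : realType} {d : nat} {G : finType}.
Notation Rd := 'rV[R]_d.
Notation leb := (@lebesgue_rV R d).
Variables (K : G -> G -> R) (tau : R) (W : Rd -> R).
Hypothesis K_ge0 : forall g g', 0 <= K g g'.
Hypothesis K_sym : forall g g', K g g' = K g' g.
Hypothesis tau_gt0 : 0 < tau.
Hypothesis mW : measurable_fun setT W.
Variables (mu sigma : G -> {finite_measure set Rd -> \bar R}).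
Hypothesis mu_P2 : P2 mu.
Hypothesis sigma_P2 : P2 sigma.
Hypothesis sigma_ac : abs_cont sigma.

Local Notation c := (@cost R d tau).
Local Notation ADM := (ADM K W tau mu sigma).
Local Notation exchange := (exchange K W tau).

Definition sigma_density (g : G) (y : Rd) : R := fine (density (sigma g) y).

Lemma sigma_densityE g y : density (sigma g) y = (sigma_density g y)%:E.
Proof.
rewrite /sigma_density fineK//; apply: Radon_Nikodym_fin_num.
exact: sigma_ac.
Qed.

Lemma sigma_density_integrable g : integrableR leb (sigma_density g).
Proof.
have := Radon_Nikodym_integrable
  (sigma_ac g : charge_of_finite_measure (sigma g) `<< leb).
by apply: eq_integrable => // x _; rewrite /= -sigma_densityE.
Qed.

Lemma sigma_density_integral g A : measurable A ->
  sigma g A = (\int[leb]_(x in A) (sigma_density g x)%:E)%E.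
Proof.
move=> mA; transitivity (charge_of_finite_measure (sigma g) A) => //.
rewrite (Radon_Nikodym_integral
  (sigma_ac g : charge_of_finite_measure (sigma g) `<< leb) mA).
by apply: eq_integral => x _; rewrite -sigma_densityE.
Qed.

Definition target_density (h : G -> G -> Rd -> R) (g : G) (y : Rd) : R :=
  sigma_density g y + exchange h g y.

Lemma fbarE h g y : fbar K W tau sigma h g y = (target_density h g y)%:E.
Proof. by rewrite /fbar sigma_densityE -EFinD. Qed.

Definition energy_density (h : G -> G -> Rd -> R) (y : Rd) : R :=
  \sum_g \sum_g' (h g g' y) ^+ 2 * K g g' * expR (- W y).

Lemma measurable_expW : measurable_fun setT (fun y : Rd => expR (- W y)).
Proof.
by apply: measurableT_comp => //; exact: measurableT_comp.
Qed.

Lemma measurable_energy_term (h : G -> G -> Rd -> R) g g' :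
  measurable_fun setT (h g g') ->
  measurable_fun setT (fun y : Rd => (h g g' y) ^+ 2 * K g g' * expR (- W y)).
Proof.
move=> mh; apply: measurable_funM; last exact: measurable_expW.
by apply: measurable_funM => //; exact: measurable_funX.
Qed.

Lemma energy_term_ge0 (h : G -> G -> Rd -> R) g g' y :
  0 <= h g g' y ^+ 2 * K g g' * expR (- W y).
Proof.
apply: mulr_ge0; last exact: expR_ge0.
by apply: mulr_ge0 => //; exact: sqr_ge0.
Qed.

(** Antisymmetry of [h] and symmetry of [K]: at each point the exchange moves mass between layers
    and creates none. *)
Lemma exchange_sum0 (h : G -> G -> Rd -> R) :
  (forall g g' x, h g g' x = - h g' g x) ->
  forall y, \sum_g exchange h g y = 0.
Proof.
move=> ha y; rewrite -mulr_sumr; set S := \sum_g _.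
suff : S = - S by move=> SN; rewrite (_ : S = 0) ?mulr0//; lra.
rewrite /S -sumrN exchange_big/=; apply: eq_bigr => g _.
rewrite -sumrN; apply: eq_bigr => g' _.
by rewrite (ha g' g) (K_sym g' g) !mulNr.
Qed.

Lemma h_energyE (h : G -> G -> Rd -> R) :
  (forall g g', measurable_fun setT (h g g')) ->
  h_energy K W h = (\int[leb]_y (energy_density h y)%:E)%E.
Proof.
move=> mh.
have e0 := energy_term_ge0 h.
under [RHS]eq_integral => y _.
  rewrite -sumEFin; under eq_bigr do rewrite -sumEFin; over.
rewrite ge0_integral_sum//; last 2 first.
- move=> g; apply: emeasurable_sum => g'; apply/measurable_EFinP.
  exact: measurable_energy_term.
- by move=> g y _; apply: sume_ge0 => g' _; rewrite lee_fin.
apply: eq_bigr => g _; rewrite ge0_integral_sum//.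
  by move=> g'; apply/measurable_EFinP; exact: measurable_energy_term.
by move=> g' y _; rewrite lee_fin.
Qed.

Lemma energy_density_ge0 (h : G -> G -> Rd -> R) y : 0 <= energy_density h y.
Proof.
apply: sumr_ge0 => g _; apply: sumr_ge0 => g' _; exact: energy_term_ge0.
Qed.

Section one_pair.
Variables (gamma : G -> {measure set (Rd * Rd) -> \bar R}).
Variables (h : G -> G -> Rd -> R).
Hypothesis adm : ADM gamma h.

Let mh g g' : measurable_fun setT (h g g'). Proof. by case: adm. Qed.

Lemma adm_fst g A : measurable A -> gamma g (fst @^-1` A) = mu g A.
Proof. by case: adm => H _ _ _ _ mA; rewrite -H// setXT. Qed.

Lemma adm_mass g : gamma g setT = mu g setT.
Proof. by rewrite -adm_fst// preimage_setT. Qed.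

Lemma adm_lty g : (gamma g setT < +oo)%E.
Proof. by rewrite adm_mass -ge0_fin_numE// fin_num_measure. Qed.

Lemma measurable_exchange g : measurable_fun setT (exchange h g).
Proof.
apply: measurable_funM => //; apply: measurable_sum => g'.
by apply: measurable_funM; [exact: measurable_funM|exact: measurable_expW].
Qed.

(** [sigma g A] is finite, and an extended difference is finite only if both of its terms are. *)
Lemma adm_exchange_fin g A : measurable A ->
  (\int[leb]_(x in A) (exchange h g x)%:E)%E \is a fin_num.
Proof.
move=> mA; case: adm => _ _ _ _ /(_ g A mA) E.
have : sigma g A \is a fin_num by exact: fin_num_measure.
by rewrite E fin_numB => /andP[].
Qed.

Lemma exchange_integrable g : integrableR leb (exchange h g).
Proof.
have mE := measurable_exchange g.
pose P : set Rd := exchange h g @^-1` `[0, +oo[.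
have mP : measurable P by rewrite -[P]setTI; exact: mE.
apply/integrableP; split; first exact/measurable_EFinP.
rewrite -(setUv P) ge0_integral_setU//.
- apply: lte_add_pinfty.
    rewrite (_ : (\int[_]_(x in _) _ =
        \int[leb]_(x in P) (exchange h g x)%:E)%E).
      by rewrite ltey_eq adm_exchange_fin.
    apply: eq_integral => x; rewrite inE /P /preimage/= in_itv/= andbT => x0.
    by rewrite ger0_norm.
  have : (\int[leb]_(x in ~` P) (exchange h g x)%:E)%E \is a fin_num.
    by apply: adm_exchange_fin; exact: measurableC.
  rewrite (_ : (\int[leb]_(x in _) _ =
      \int[leb]_(x in ~` P) - `|(exchange h g x)%:E|)%E).
    by rewrite integral_ge0N// fin_numN => ?; rewrite ltey_eq; apply/orP; left.
  apply: eq_integral => x; rewrite inE /P /preimage/= in_itv/= andbT => /negP.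
  by rewrite -ltNge => x0; rewrite ltr0_norm// opprK.
- exact: measurableC.
- rewrite setUv; apply: measurableT_comp => //; exact/measurable_EFinP.
- by apply/disj_set2P; rewrite setICr.
Qed.

Definition snd_marginal (m : {measure set (Rd * Rd) -> \bar R}) :
    {measure set Rd -> \bar R} :=
  measure_function_pushforward__canonical__measure_function_Measure
    m (@measurable_snd _ _ Rd Rd).

Lemma snd_marginal_density g A : measurable A ->
  snd_marginal (gamma g) A =
    (\int[leb]_(x in A) (target_density h g x)%:E)%E.
Proof.
move=> mA; case: adm => _ _ _ _ /(_ g A mA) E.
have -> : snd_marginal (gamma g) A = gamma g (setT `*` A) by rewrite setTX.
rewrite integralD_EFin//; first last.
- exact: integrableS (exchange_integrable g).
- exact: integrableS (sigma_density_integrable g).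
rewrite -sigma_density_integral// E subeK//; exact: adm_exchange_fin.
Qed.

Lemma target_density_integrable g : integrableR leb (target_density h g).
Proof.
by apply: integrableRD;
  [exact: sigma_density_integrable|exact: exchange_integrable].
Qed.

Lemma target_density_ge0 g : {ae leb, forall y, 0 <= target_density h g y}.
Proof.
exact: (density_ae_ge0 (target_density_integrable g) (@snd_marginal_density g)).
Qed.

Lemma adm_snd_integrable g (u : Rd -> R) : measurable_fun setT u ->
  integrableR (gamma g) (fun p => u p.2) <->
  integrableR leb (fun y => u y * target_density h g y).
Proof.
move=> mu'; have H1 := @marginal_integrable _ _ _ _ _ snd measurable_snd
  (gamma g) (snd_marginal (gamma g)) (fun _ _ => erefl) u mu'.
have H2 := density_integrable (target_density_integrable g)
  (@snd_marginal_density g) mu'.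
by split=> [/H1/H2|/H2/H1].
Qed.

Lemma adm_snd_integral g (u : Rd -> R) : measurable_fun setT u ->
  integrableR (gamma g) (fun p => u p.2) ->
  \int[gamma g]_p u p.2 = \int[leb]_y (u y * target_density h g y).
Proof.
move=> mu' ui; have := @marginal_integrable _ _ _ _ _ snd measurable_snd
  (gamma g) (snd_marginal (gamma g)) (fun _ _ => erefl) u mu'.
move=> [/(_ ui) ui' _].
rewrite (@marginal_integral _ _ _ _ _ snd measurable_snd
  (gamma g) (snd_marginal (gamma g)))//.
exact: (density_integral (target_density_integrable g)
  (@snd_marginal_density g)).
Qed.

Lemma adm_fst_integrable g (u : Rd -> R) : measurable_fun setT u ->
  integrableR (gamma g) (fun p => u p.1) <-> integrableR (mu g) u.
Proof.
exact: (@marginal_integrable _ _ _ _ _ fst measurable_fst (gamma g) (mu g)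
  (@adm_fst g)).
Qed.

Lemma adm_fst_integral g (u : Rd -> R) : measurable_fun setT u ->
  integrableR (mu g) u -> \int[gamma g]_p u p.1 = \int[mu g]_x u x.
Proof.
exact: (@marginal_integral _ _ _ _ _ fst measurable_fst (gamma g) (mu g)
  (@adm_fst g)).
Qed.

Lemma adm_cst_integrable g (k : R) : integrableR (gamma g) (fun=> k).
Proof.
apply: (@measurable_bounded_integrable _ _ _ (gamma g)) => //.
  exact: adm_lty.
exact: bounded_cst.
Qed.

Lemma P2_moment (m : G -> {finite_measure set Rd -> \bar R}) g : P2 m ->
  integrableR (m g) (@sqnorm R d).
Proof.
move=> [_ H]; apply: integrableR_ge0; first exact: measurable_sqnorm.
  exact: sqnorm_ge0.
apply: le_lt_trans H; rewrite (bigD1 g)//= leeDl// sume_ge0// => g' _.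
by apply: integral_ge0 => x _; rewrite lee_fin sqnorm_ge0.
Qed.

Lemma adm_fst_moment g : integrableR (gamma g) (fun p => sqnorm p.1).
Proof.
by apply/adm_fst_integrable; [exact: measurable_sqnorm|exact: P2_moment].
Qed.

(** The exchange term of a single layer has no second moment bound of its own. It cancels in the sum
    over layers, so each target density, being nonnegative, is at most the sum of all the densities
    of [sigma]. *)
Lemma adm_snd_moment g : integrableR (gamma g) (fun p => sqnorm p.2).
Proof.
have msq := @measurable_sqnorm R d.
apply/adm_snd_integrable => //.
apply: (@integrableR_ae_le _ _ _ _ _
    (fun y => \sum_g' sqnorm y * sigma_density g' y)).
- apply: measurable_funM => //.
  exact: integrableR_measurable (target_density_integrable g).
- apply: filterS (ae_forall_fin target_density_ge0) => y Fy.
  rewrite ger0_norm ?mulr_ge0 ?sqnorm_ge0// -mulr_sumr ler_wpM2l ?sqnorm_ge0//.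
  have -> : \sum_g' sigma_density g' y = \sum_g' target_density h g' y.
    by rewrite big_split/= exchange_sum0 ?addr0//; case: adm.
  by rewrite (bigD1 g)//= lerDl sumr_ge0.
- apply: integrableR_sum => g' _; apply/(density_integrable
    (sigma_density_integrable g') (@sigma_density_integral g')) => //.
  exact: P2_moment.
Qed.

(** These are the upper bounds that [envelope_ub] provides for a potential and its transform. *)
Lemma quad_integrable g (k : R) :
  integrableR (gamma g) (fun p => sqnorm p.1 / tau + k) /\
  integrableR (gamma g) (fun p => sqnorm p.2 / tau + k).
Proof.
by split; under eq_fun do rewrite mulrC; apply: integrableRD;
  rewrite ?adm_cst_integrable//; apply: integrableRZ;
  [exact: adm_fst_moment|exact: adm_snd_moment].
Qed.

Lemma adm_cost_integrable g : integrableR (gamma g) (fun p => c p.1 p.2).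
Proof.
apply: (@integrable_le _ _ _ _ _
    (fun p => tau^-1 * (sqnorm p.1 + sqnorm p.2))).
- exact: measurable_cost.
- by move=> p; rewrite ger0_norm ?cost_ge0// mulrC cost_le.
- apply: integrableRZ; apply: integrableRD;
    [exact: adm_fst_moment|exact: adm_snd_moment].
Qed.

Lemma energy_density_integrable : integrableR leb (energy_density h).
Proof.
apply: integrableR_ge0; last by rewrite -h_energyE//; case: adm.
  apply: measurable_sum => g; apply: measurable_sum => g'.
  exact: measurable_energy_term.
exact: energy_density_ge0.
Qed.

(** Every admissible pair has finite cost, so costs can be compared as real numbers. *)
Lemma total_costE : total_cost K W tau gamma h =
  (\sum_g \int[gamma g]_p c p.1 p.2 +
   tau / 4 * \int[leb]_y energy_density h y)%:E.
Proof.
rewrite /total_cost EFinD -sumEFin; congr (_ + _)%E.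
  apply: eq_bigr => g _; rewrite -RintegralE; last exact: adm_cost_integrable.
  rewrite -ge0_integralZl_EFin//.
  - by apply: eq_integral => p _; rewrite -EFinM /cost mulrC.
  - by move=> p _; rewrite lee_fin sqnorm_ge0.
  - apply/measurable_EFinP; apply: measurableT_comp.
      exact: measurable_sqnorm.
    apply: measurable_fun_rVP => i; under eq_fun do rewrite !mxE.
    by apply: measurable_funB; apply: (measurableT_comp (measurable_coord i)).
  - by rewrite invr_ge0 mulr_ge0// ltW.
rewrite [in RHS]EFinM h_energyE// RintegralE//.
exact: energy_density_integrable.
Qed.

End one_pair.
End admissible_pairs.

(** * Potentials certify optimality *)

Section sufficiency.
Context {R : realType} {d : nat} {G : finType}.
Notation Rd := 'rV[R]_d.
Notation leb := (@lebesgue_rV R d).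
Variables (K : G -> G -> R) (tau : R) (W : Rd -> R).
Hypothesis K_ge0 : forall g g', 0 <= K g g'.
Hypothesis K_sym : forall g g', K g g' = K g' g.
Hypothesis tau_gt0 : 0 < tau.
Hypothesis mW : measurable_fun setT W.
Variables (mu sigma : G -> {finite_measure set Rd -> \bar R}).
Hypothesis mu_P2 : P2 mu.
Hypothesis sigma_P2 : P2 sigma.
Hypothesis sigma_ac : abs_cont sigma.

Local Notation c := (@cost R d tau).
Local Notation ADM := (ADM K W tau mu sigma).
Local Notation exchange := (exchange K W tau).
Local Notation target_density := (target_density K tau W sigma).

(** Summation by parts on the graph: averaging the terms for [(g, g')] and [(g', g)] produces
    differences of [phi] along edges, whence the factor 1/2. Pairs with [K g g' = 0] contribute
    nothing, so [h] has to be a gradient on true edges only. *)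
Lemma exchange_pairing (h k : G -> G -> Rd -> R) (phi : G -> Rd -> R) y :
  (forall g g', k g g' y = - k g' g y) ->
  (forall g g', 0 < K g g' -> phi g' y - phi g y = h g g' y) ->
  \sum_g phi g y * exchange k g y =
    - (tau / 2 * \sum_g \sum_g' h g g' y * k g g' y * K g g' * expR (- W y)).
Proof.
move=> ka phih; pose T g g' := phi g y * (k g g' y * K g g' * expR (- W y)).
have -> : \sum_g phi g y * exchange k g y = tau * \sum_g \sum_g' T g g'.
  rewrite mulr_sumr; apply: eq_bigr => g _.
  by rewrite mulrCA; congr (_ * _); rewrite mulr_sumr.
rewrite -mulrA -mulrN; congr (_ * _).
have -> : \sum_g \sum_g' T g g' =
    2^-1 * (\sum_g \sum_g' (T g g' + T g' g)).
  under [in RHS]eq_bigr do rewrite big_split/=.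
  rewrite big_split/= [X in _ + X]exchange_big/=; set S := \sum_g _.
  by lra.
rewrite -mulrN; congr (_ * _); rewrite -sumrN; apply: eq_bigr => g _.
rewrite -sumrN; apply: eq_bigr => g' _; rewrite /T (ka g' g) (K_sym g' g).
have [K0|] := ltP 0 (K g g'); first by rewrite -(phih _ _ K0); ring.
by move=> K0; rewrite (_ : K g g' = 0); [ring|apply/le_anti; rewrite K0 K_ge0].
Qed.

Variables (gamma gamma' : G -> {measure set (Rd * Rd) -> \bar R}).
Variables (h h' : G -> G -> Rd -> R).
Hypothesis adm : ADM gamma h.
Hypothesis adm' : ADM gamma' h'.

Let mh g g' : measurable_fun setT (h g g'). Proof. by case: adm. Qed.
Let mh' g g' : measurable_fun setT (h' g g'). Proof. by case: adm'. Qed.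

(** Half the derivative of the energy density at [h] in the direction [h' - h]. *)
Definition cross_density (y : Rd) : R :=
  \sum_g \sum_g' h g g' y * (h' g g' y - h g g' y) * K g g' * expR (- W y).

Lemma cross_density_bound y :
  `|cross_density y| <= 2 * energy_density K W h y + energy_density K W h' y.
Proof.
rewrite /cross_density /energy_density mulr_sumr -big_split/=.
rewrite (le_trans (ler_norm_sum _ _ _))//; apply: ler_sum => g _.
rewrite mulr_sumr -big_split/= (le_trans (ler_norm_sum _ _ _))//.
apply: ler_sum => g' _; rewrite !normrM (ger0_norm (K_ge0 _ _)).
rewrite (ger0_norm (expR_ge0 _)) mulrA mulrA -!mulrDl.
rewrite ler_wpM2r ?expR_ge0// ler_wpM2r//.
set a := h g g' y; set b := h' g g' y; rewrite -normrM ler_norml.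
have := sqr_ge0 (a + b); have := sqr_ge0 (a - b); have := sqr_ge0 a.
by have := sqr_ge0 b; rewrite !expr2 => ? ? ? ?; apply/andP; split; lra.
Qed.

Lemma cross_density_integrable : integrableR leb cross_density.
Proof.
apply: (integrable_le _ cross_density_bound).
  apply: measurable_sum => g; apply: measurable_sum => g'.
  apply: measurable_funM; last exact: measurable_expW.
  apply: measurable_funM => //; apply: measurable_funM => //.
  exact: measurable_funB.
apply: integrableRD; last exact: (energy_density_integrable K_ge0 mW adm').
by apply: integrableRZ; exact: (energy_density_integrable K_ge0 mW adm).
Qed.

Lemma energy_convexity : 2 * \int[leb]_y cross_density y <=
  \int[leb]_y energy_density K W h' y - \int[leb]_y energy_density K W h y.
Proof.
have ie := energy_density_integrable K_ge0 mW adm.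
have ie' := energy_density_integrable K_ge0 mW adm'.
rewrite -RintegralB//.
rewrite -[X in X <= _]RintegralZl//; last exact: cross_density_integrable.
apply: Rintegral_ae_le.
- by apply: integrableRZ; exact: cross_density_integrable.
- exact: integrableRB.
apply/aeW => y; rewrite /cross_density /energy_density -sumrB mulr_sumr.
apply: ler_sum => g _; rewrite -sumrB mulr_sumr; apply: ler_sum => g' _.
rewrite -!mulrBl !mulrA ler_wpM2r ?expR_ge0// ler_wpM2r//.
by have := sqr_ge0 (h' g g' y - h g g' y); rewrite !expr2; lra.
Qed.

Lemma potentials_sufficient (phi : G -> Rd -> R) :
  potentials K tau gamma h phi phi ->
  (total_cost K W tau gamma h <= total_cost K W tau gamma' h')%E.
Proof.
move=> [cphi hphi _].
have Fi := target_density_integrable mW sigma_ac adm.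
have Fi' := target_density_integrable mW sigma_ac adm'.
have mF g := integrableR_measurable (Fi g).
have mF' g := integrableR_measurable (Fi' g).
have mphi g := c_concave_measurable tau_gt0 (cphi g).1.
have /choice[psi Hpsi] g : exists psi, lower_envelope tau setT id (phi g) psi.
  exact: c_concave_transform (cphi g).1.
have mpsi g := measurable_envelope tau_gt0 (Hpsi g).
have /choice[eta Heta] g : exists eta, lower_envelope tau setT id eta (phi g).
  by have /c_concaveP := (cphi g).1.
(* A single quadratic function [q g] is to dominate both [phi g] and [psi g]; the two summands are
   the constants of [envelope_ub] for each of them. *)
pose C (g : G) : R := `|eta g 0| + `|phi g 0|.
pose q (g : G) (y : Rd) : R := sqnorm y / tau + C g.
have q0 g y : 0 <= q g y.
  apply: addr_ge0; last exact: addr_ge0.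
  by apply: divr_ge0; [exact: sqnorm_ge0|exact: ltW].
have phiq g y : phi g y <= q g y.
  by rewrite (le_trans (envelope_ub tau_gt0 (Heta g) y))// /q lerD2l /C lerDl.
have psiq g y : psi g y <= q g y.
  by rewrite (le_trans (envelope_ub tau_gt0 (Hpsi g) y))// /q lerD2l /C lerDr.
have mq g : measurable_fun setT (q g).
  apply: measurable_funD => //; apply: measurable_funM => //.
  exact: measurable_sqnorm.
have young g x y : psi g x + phi g y <= c x y.
  by have := (Hpsi g).1 y x I; rewrite costC/=; lra.
have qi g := quad_integrable K_sym mW mu_P2 sigma_P2 sigma_ac adm g (C g).
have qi' g := quad_integrable K_sym mW mu_P2 sigma_P2 sigma_ac adm' g (C g).
have ci g := adm_cost_integrable K_sym tau_gt0 mW mu_P2 sigma_P2 sigma_ac adm g.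
have ci' g := adm_cost_integrable K_sym tau_gt0 mW mu_P2 sigma_P2 sigma_ac
  adm' g.
have tight g : {ae gamma g, forall p, psi g p.1 + phi g p.2 = c p.1 p.2}.
  have [_ H] := cphi g; apply: negligibleS H => p /= H1 H2; apply: H1.
  by move: H2; rewrite (c_superdiffE (Hpsi g)).
have mpsi1 g : measurable_fun setT (fun p : Rd * Rd => psi g p.1).
  exact: measurableT_comp.
have mphi2 g : measurable_fun setT (fun p : Rd * Rd => phi g p.2).
  exact: measurableT_comp.
(* On the plan [psi + phi = c] is nonnegative while each term is at most [q], so each term is also
   bounded below by minus the bound of the other. *)
have psi_i g : integrableR (gamma g) (fun p => psi g p.1).
  apply: (@integrableR_ae_le _ _ _ _ _ (fun p => q g p.1 + q g p.2)) => //.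
    apply: filterS (tight g) => p Hp; rewrite ler_norml.
    have := cost_ge0 tau_gt0 p.1 p.2; have := phiq g p.2; have := psiq g p.1.
    have := q0 g p.1; have := q0 g p.2 => ? ? ? ? ?.
    by apply/andP; split; lra.
  by apply: integrableRD; have [] := qi g.
have phi_i g : integrableR (gamma g) (fun p => phi g p.2).
  apply: (@integrableR_ae_le _ _ _ _ _ (fun p => q g p.1 + q g p.2)) => //.
    apply: filterS (tight g) => p Hp; rewrite ler_norml.
    have := cost_ge0 tau_gt0 p.1 p.2; have := phiq g p.2; have := psiq g p.1.
    have := q0 g p.1; have := q0 g p.2 => ? ? ? ? ?.
    by apply/andP; split; lra.
  by apply: integrableRD; have [] := qi g.
have costE g : \int[gamma g]_p c p.1 p.2 =
    \int[gamma g]_p psi g p.1 + \int[gamma g]_p phi g p.2.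
  rewrite -RintegralD//; apply: Rintegral_ae_eq => //.
  - exact: measurable_cost.
  - exact: measurable_funD.
  - by apply: filterS (tight g) => p <-.
have psi_mu g : integrableR (mu g) (psi g) by apply/(adm_fst_integrable adm).
(* Both plans have first marginal [mu g], through which the integrability of [psi] passes to the
   competitor. The second marginals differ, and [phi] requires the longer argument below. *)
have psi_i' g : integrableR (gamma' g) (fun p => psi g p.1).
  exact/(adm_fst_integrable adm').
have phiF g : integrableR leb (fun y => phi g y * target_density h g y).
  exact/(adm_snd_integrable mW sigma_ac adm).
have qF g : integrableR leb (fun y => q g y * target_density h' g y).
  by apply/(adm_snd_integrable mW sigma_ac adm') => //; have [] := qi' g.
pose Delta g y := phi g y * (target_density h' g y - target_density h g y).
pose U g y := q g y * target_density h' g y + `|phi g y * target_density h g y|.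
have Ui g : integrableR leb (U g).
  by apply: integrableRD => //; exact: integrableR_norm.
have F0' := ae_forall_fin (target_density_ge0 mW sigma_ac adm').
have F0 := ae_forall_fin (target_density_ge0 mW sigma_ac adm).
have DeltaU : {ae leb, forall y, forall g, Delta g y <= U g y}.
  apply: filterS F0' => y F0y g; rewrite /Delta /U mulrBr lerD//.
    by rewrite ler_wpM2r.
  by rewrite -normrN ler_norm.
have U0 : {ae leb, forall y, forall g, 0 <= U g y}.
  by apply: filterS F0' => y F0y g; rewrite addr_ge0// mulr_ge0.
(* The density of [sigma] cancels in the difference of target densities. What remains is the
   exchange of [h' - h], to which summation by parts applies. *)
have DeltaS : {ae leb, forall y,
    \sum_g Delta g y = - (tau / 2 * cross_density y)}.
  apply: filterS hphi => y Hy; 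
  rewrite -(@exchange_pairing h (fun g g' y => h' g g' y - h g g' y) phi y)//;
    last first.
    move=> g g'; case: adm => _ _ ha _ _; case: adm' => _ _ ha' _ _.
    by rewrite (ha g g') (ha' g g'); ring.
  apply: eq_bigr => g _; rewrite /Delta /target_density; congr (_ * _).
  rewrite opprD addrACA subrr add0r /Defs.exchange -mulrBr -sumrB.
  by congr (_ * _); apply: eq_bigr => g' _; rewrite -!mulrBl.
have Si : integrableR leb (fun y => - (tau / 2 * cross_density y)).
  have := integrableRZ (- (tau / 2)) cross_density_integrable.
  by under eq_fun do rewrite mulNr.
have mDelta g : measurable_fun setT (Delta g).
  by apply: measurable_funM => //; exact: measurable_funB.
have Delta_i g : integrableR leb (Delta g).
  apply: (@integrableR_ae_le _ _ _ _ _
    (fun y => `|- (tau / 2 * cross_density y)| + \sum_g' U g' y)) => //.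
    apply: filterS2 (filterI U0 DeltaU) DeltaS => y [Uy Dy] Sy.
    rewrite -Sy; set S := \sum_g' Delta g' y.
    (* One term equals the sum minus the other terms; upper bounds on the others thus become a lower
       bound on this one. *)
    have DE : Delta g y = S - \sum_(g' | g' != g) Delta g' y.
      by rewrite /S (bigD1 g)//= addrK.
    have SU : \sum_g' U g' y = U g y + \sum_(g' | g' != g) U g' y.
      by rewrite (bigD1 g).
    have le1 : \sum_(g' | g' != g) Delta g' y <= \sum_(g' | g' != g) U g' y.
      exact: ler_sum.
    have ge0 : 0 <= \sum_(g' | g' != g) U g' y by exact: sumr_ge0.
    have := Uy g; have := Dy g; have := ler_norm S; have := ler_norm (- S).
    rewrite normrN SU => ? ? ? ?; rewrite ler_norml; apply/andP; split.
      by rewrite {1}DE; lra.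
    by have := normr_ge0 S; lra.
  apply: integrableRD; first exact: integrableR_norm.
  exact: integrableR_sum.
have phiF' g : integrableR leb (fun y => phi g y * target_density h' g y).
  have := integrableRD (Delta_i g) (phiF g).
  by apply: eq_integrable => // y _; rewrite /= /Delta; congr EFin; ring.
have phi_i' g : integrableR (gamma' g) (fun p => phi g p.2).
  exact/(adm_snd_integrable mW sigma_ac adm').
have costE' g : \int[gamma' g]_p psi g p.1 + \int[gamma' g]_p phi g p.2 <=
    \int[gamma' g]_p c p.1 p.2.
  rewrite -RintegralD//; apply: Rintegral_ae_le => //.
    exact: integrableRD.
  exact/aeW.
rewrite (total_costE K_ge0 K_sym tau_gt0 mW mu_P2 sigma_P2 sigma_ac adm).
rewrite (total_costE K_ge0 K_sym tau_gt0 mW mu_P2 sigma_P2 sigma_ac adm').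
rewrite lee_fin.
have DI : \sum_g \int[leb]_y Delta g y =
    - (tau / 2 * \int[leb]_y cross_density y).
  rewrite -Rintegral_sum// (Rintegral_ae_eq _ _ DeltaS); last 2 first.
  - exact: measurable_sum.
  - exact: integrableR_measurable Si.
  rewrite -mulNr -RintegralZl//; last exact: cross_density_integrable.
  by apply: eq_Rintegral => y _; rewrite mulNr.
have : \sum_g \int[leb]_y Delta g y <=
    \sum_g \int[gamma' g]_p c p.1 p.2 - \sum_g \int[gamma g]_p c p.1 p.2.
  rewrite -sumrB; apply: ler_sum => g _; rewrite costE.
  have := costE' g; rewrite (adm_fst_integral adm')// (adm_fst_integral adm)//.
  rewrite (adm_snd_integral mW sigma_ac adm')//.
  rewrite (adm_snd_integral mW sigma_ac adm)//.
  suff -> : \int[leb]_y Delta g y =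
    \int[leb]_y (phi g y * target_density h' g y) -
    \int[leb]_y (phi g y * target_density h g y) by lra.
  by rewrite -RintegralB//; apply: eq_Rintegral => y _; rewrite /Delta mulrBr.
rewrite DI; have := energy_convexity.
set a := \int[leb]_y cross_density y.
set E := \int[leb]_y energy_density K W h y.
set E' := \int[leb]_y energy_density K W h' y.
set I1 := \sum_g _; set I2 := \sum_g _ => H1 H2.
(* The coefficient [tau / 4] of the energy and the factor 2 of the convexity inequality match the
   [tau / 2] of the pairing exactly. *)
have : tau / 4 * (2 * a) <= tau / 4 * (E' - E).
  by rewrite ler_wpM2l// divr_ge0// ltW.
rewrite (_ : tau / 4 * (2 * a) = tau / 2 * a); last by field.
rewrite mulrBr => H3.
lra.
Qed.

End sufficiency.

(** * Removing, adding and truncating mass *)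

Section weighted_measure.
Context d (T : measurableType d) (R : realType).
Variables (m : {measure set T -> \bar R}) (w : T -> R).
Hypotheses (mw : measurable_fun setT w) (w0 : forall x, 0 <= w x).

(** Carrying the two proofs as arguments allows the structure of measure to be attached to the term
    itself. *)
Definition wmeasure & measurable_fun setT w & (forall x, 0 <= w x) :
  set T -> \bar R := fun A => (\int[m]_(x in A) (w x)%:E)%E.

Local Notation wm := (wmeasure mw w0).

Let wm0 : wm set0 = 0%E. Proof. exact: integral_set0. Qed.

Let wm_ge0 A : (0 <= wm A)%E.
Proof. by apply: integral_ge0 => x _; rewrite lee_fin. Qed.

Let wm_sigma_additive : semi_sigma_additive wm.
Proof.
apply: semi_sigma_additive_nng_induced; first exact/measurable_EFinP.
by move=> x; rewrite lee_fin.
Qed.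

HB.instance Definition _ := isMeasure.Build _ _ _ wm
  wm0 wm_ge0 wm_sigma_additive.

End weighted_measure.

Section measure_surgery.
Context d (T : measurableType d) (R : realType).

Lemma integral_mrestr (m : {measure set T -> \bar R}) (S : set T)
    (mS : measurable S) (f : T -> \bar R) :
  measurable_fun setT f -> (forall x, 0 <= f x)%E ->
  (\int[mrestr m mS]_x f x = \int[m]_(x in S) f x)%E.
Proof.
move=> mf f0; rewrite -[X in (\int[_]_(x in X) _)%E](setUv S).
rewrite ge0_integral_setU//; last 3 first.
- exact: measurableC.
- exact: measurable_funTS.
- by apply/disj_set2P; rewrite setICr.
rewrite (eq_measure_integral m); last first.
  by move=> A mA AS; rewrite /= /mrestr setIidl.
rewrite [X in (_ + X)%E](_ : _ = 0%E) ?adde0//.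
apply: null_set_integral => //; first exact: measurableC.
  exact: measurable_funTS.
by rewrite /= /mrestr setICl measure0.
Qed.

(** The remainder is [m] weighted by one minus the sum of the [a i] times the indicators of the
    [S i]. This weight is nonnegative however much the [S i] overlap, because the [a i] add up to at
    most 1. *)
Lemma measure_subtract (m : {measure set T -> \bar R}) N (a : nat -> R)
    (S : nat -> set T) :
  (m setT < +oo)%E -> (forall i, 0 <= a i) -> \sum_(i < N) a i <= 1 ->
  (forall i, measurable (S i)) ->
  exists rho : {measure set T -> \bar R}, forall X, measurable X ->
    (m X = rho X + \sum_(i < N) (a i)%:E * m (S i `&` X))%E.
Proof.
move=> moo a0 a1 mS; pose w x : R := 1 - \sum_(i < N) a i * \1_(S i) x.
have mw : measurable_fun setT w.
  apply: measurable_funB => //; apply: measurable_sum => i.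
  by apply: measurable_funM => //; exact: measurable_indic.
have ind1 i x : 0 <= (\1_(S i) x : R) <= 1.
  by rewrite indicE; case: (_ \in _); rewrite /= ?lexx ler01.
have w0 x : 0 <= w x.
  rewrite subr_ge0 (le_trans _ a1)//; apply: ler_sum => i _.
  by rewrite ler_piMr//; case/andP: (ind1 i x).
exists (wmeasure m mw w0) => X mX.
change (m X = \int[m]_(x in X) (w x)%:E +
  \sum_(i < N) (a i)%:E * m (S i `&` X))%E.
have iaS (i : nat) : (\int[m]_(x in X) (a i * \1_(S i) x)%:E)%E =
    ((a i)%:E * m (S i `&` X))%E.
  under eq_integral do rewrite EFinM.
  rewrite ge0_integralZl_EFin//; last first.
    by apply/measurable_EFinP/measurable_funTS; apply: measurable_indic.
  by rewrite integral_indic.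
under eq_bigr do rewrite -iaS.
have mterm (i : nat) : measurable_fun X (fun x => (a i * \1_(S i) x)%:E).
  by apply/measurable_EFinP/measurable_funTS; apply: measurable_funM.
have term0 (i : nat) x : (0 <= (a i * \1_(S i) x)%:E)%E.
  by rewrite lee_fin mulr_ge0//; case/andP: (ind1 i x).
rewrite -(@ge0_integral_sum _ _ _ m _ mX _
  (fun (i : 'I_N) x => (a i * \1_(S i) x)%:E))//.
rewrite -ge0_integralD//; last 4 first.
- by move=> x _; rewrite lee_fin.
- by apply/measurable_EFinP/measurable_funTS.
- by move=> x _; exact: sume_ge0.
- exact: emeasurable_sum.
rewrite (eq_integral (cst 1%E)) ?integral_cst ?mul1e// => x _.
by rewrite sumEFin -EFinD /w subrK.
Qed.

(* [m'] is [m - \sum_i a i * m|_(S i) + \sum_i a i * lam i]; the negative terms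
   are moved to the other side, as there is no subtraction of measures. *)
Lemma measure_replace (m : {measure set T -> \bar R}) N (a : nat -> R)
    (S : nat -> set T) (lam : nat -> {measure set T -> \bar R}) :
  (m setT < +oo)%E -> (forall i, 0 <= a i) -> \sum_(i < N) a i <= 1 ->
  (forall i, measurable (S i)) ->
  exists m' : {measure set T -> \bar R},
    (forall X, measurable X ->
      (m' X + \sum_(i < N) (a i)%:E * m (S i `&` X) =
       m X + \sum_(i < N) (a i)%:E * lam i X)%E) /\
    (forall f : T -> R, measurable_fun setT f -> (forall x, 0 <= f x) ->
      (\int[m']_x (f x)%:E +
         \sum_(i < N) (a i)%:E * \int[m]_(x in S i) (f x)%:E =
       \int[m]_x (f x)%:E + \sum_(i < N) (a i)%:E * \int[lam i]_x (f x)%:E)%E).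
Proof.
move=> moo a0 a1 mS; have [rho Hrho] := measure_subtract moo a0 a1 mS.
pose an i : {nonneg R} := NngNum (a0 i).
pose scl i : {measure set T -> \bar R} := mscale (an i) (lam i).
pose rst i : {measure set T -> \bar R} := mscale (an i) (mrestr m (mS i)).
exists (measure_add rho (msum scl N)); split => [X mX|f mf f0].
  transitivity (rho X + \sum_(i < N) (a i)%:E * lam i X +
      \sum_(i < N) (a i)%:E * m (S i `&` X))%E.
    by congr (_ + _)%E; exact: measure_addE.
  by rewrite Hrho// -!addeA; congr (_ + _)%E; exact: addeC.
have mfE : measurable_fun setT (EFin \o f) by exact/measurable_EFinP.
have fE0 x : (0 <= (f x)%:E)%E by rewrite lee_fin.
have -> : (\int[m]_x (f x)%:E =
    \int[rho]_x (f x)%:E +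
    \sum_(i < N) (a i)%:E * \int[m]_(x in S i) (f x)%:E)%E.
  rewrite (eq_measure_integral (measure_add rho (msum rst N))); last first.
    move=> X mX _; rewrite Hrho//; apply/esym.
    transitivity (rho X + msum rst N X)%E; first exact: measure_addE.
    congr (_ + _)%E; apply: eq_bigr => i _.
    by rewrite /rst/= /mscale/= /mrestr setIC.
  rewrite ge0_integral_measure_add// ge0_integral_measure_sum//.
  congr (_ + _)%E; apply: eq_bigr => i _.
  by rewrite ge0_integral_mscale// integral_mrestr.
rewrite ge0_integral_measure_add// ge0_integral_measure_sum//.
rewrite [LHS]addeAC; congr (_ + _)%E; apply: eq_bigr => i _.
by rewrite ge0_integral_mscale.
Qed.

(** The Radon-Nikodym derivative is truncated at [M 1_E] to make the bound hold at every point. No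
    mass is lost: where the derivative exceeds [M 1_E], the hypothesis on [V] bounds the mass by the
    integral of the truncation. *)
Lemma bounded_density_exists (m : {sigma_finite_measure set T -> \bar R})
    (V : {measure set T -> \bar R}) (E : set T) (M : R) :
  0 <= M -> measurable E -> (m E < +oo)%E ->
  (forall A, measurable A -> (V A <= M%:E * m (A `&` E))%E) ->
  exists v : T -> R, [/\ measurable_fun setT v,
    forall x, 0 <= v x <= M * \1_E x &
    forall A, measurable A -> V A = (\int[m]_(x in A) (v x)%:E)%E].
Proof.
move=> M0 mE Eoo VE.
have Voo : (V setT < +oo)%E.
  by rewrite (le_lt_trans (VE _ measurableT))// setTI lte_mul_pinfty.
pose V' : {finite_measure set T -> \bar R} := mfrestr measurableT Voo.
have V'E A : V' A = V A by rewrite /V'/= /mfrestr /mrestr setIT.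
have Vm : V' `<< m.
  apply/null_content_dominatesP => A mA mA0; rewrite V'E.
  apply/eqP; rewrite -measure_le0 (le_trans (VE _ mA))//.
  rewrite (_ : m (A `&` E) = 0%E) ?mule0//.
  by apply/eqP; rewrite -measure_le0 -mA0 le_measure ?inE//; exact: measurableI.
pose f := Radon_Nikodym_SigmaFinite.f V' m.
have f0 x : (0 <= f x)%E by exact: Radon_Nikodym_SigmaFinite.f_ge0.
have ffin x : f x \is a fin_num by exact: Radon_Nikodym_SigmaFinite.f_fin_num.
have mf : measurable_fun setT f.
  exact: measurable_int (Radon_Nikodym_SigmaFinite.f_integrable Vm).
have fV A : measurable A -> V A = (\int[m]_(x in A) f x)%E.
  by move=> mA; rewrite -V'E; exact: Radon_Nikodym_SigmaFinite.f_integral.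
pose fr x := fine (f x).
have frE x : (fr x)%:E = f x by rewrite fineK.
have mfr : measurable_fun setT fr by apply: measurableT_comp.
have fr0 x : 0 <= fr x by rewrite fine_ge0.
pose ME x : R := M * \1_E x.
have mME : measurable_fun setT ME.
  by apply: measurable_funM => //; exact: measurable_indic.
have ME0 x : 0 <= ME x by rewrite mulr_ge0// indicE.
pose v x := Num.min (fr x) (ME x).
have mv : measurable_fun setT v by exact: measurable_minr.
have v0 x : 0 <= v x by rewrite le_min fr0 ME0.
exists v; split => // [x|A mA]; first by rewrite v0/= ge_min lexx orbT.
pose B := [set x | fr x <= ME x].
have mB : measurable B by rewrite -[B]setTI; exact: measurable_fun_le.
have mAB : measurable (A `&` B) by exact: measurableI.
have mAC : measurable (A `\` B) by exact: measurableD.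
have splitAB (u : T -> \bar R) : measurable_fun setT u ->
    (forall x, 0 <= u x)%E -> (\int[m]_(x in A) u x =
      \int[m]_(x in A `&` B) u x + \int[m]_(x in A `\` B) u x)%E.
  move=> mu u0; rewrite -{1}(setUIDK A B) ge0_integral_setU//.
    exact: measurable_funTS.
  by apply/disj_set2P; rewrite setDE setIACA setICr setI0.
have mvE : measurable_fun setT (fun x => (v x)%:E) by exact/measurable_EFinP.
have vE0 x : (0 <= (v x)%:E)%E by rewrite lee_fin.
rewrite fV// !splitAB//.
congr (_ + _)%E.
  apply: eq_integral => x; rewrite inE => -[_ Bx].
  by rewrite /v min_l// frE.
apply/eqP; rewrite eq_le; apply/andP; split; last first.
  apply: ge0_le_integral => //; [exact: measurable_funTS..|].
  by move=> x _; rewrite -frE lee_fin ge_min lexx.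
rewrite -fV//; apply: (le_trans (VE _ mAC)).
rewrite (_ : (\int[m]_(x in A `\` B) _ =
    \int[m]_(x in A `\` B) (M%:E * (\1_E x)%:E))%E); last first.
  apply: eq_integral => x; rewrite inE => -[_ nBx].
  have Bx : ME x < fr x by rewrite ltNge; exact/negP.
  by rewrite -EFinM /v min_r// ltW.
rewrite ge0_integralZl_EFin//; last first.
  by apply/measurable_EFinP/measurable_funTS; exact: measurable_indic.
by rewrite integral_indic// setIC.
Qed.

End measure_surgery.

(* [swap_plan P Q] is the product of the first marginal of [P] and the second
   marginal of [Q]. *)
Section swap_plan.
Context d1 d2 (X : measurableType d1) (Y : measurableType d2) (R : realType).
Variables P Q : {finite_measure set (X * Y)%type -> \bar R}.

Definition swap_pair (z : (X * Y) * (X * Y)) : X * Y := (z.1.1, z.2.2).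

Lemma measurable_swap_pair : measurable_fun setT swap_pair.
Proof.
apply: measurable_fun_pair.
  exact: (measurableT_comp measurable_fst measurable_fst).
exact: (measurableT_comp measurable_snd measurable_snd).
Qed.

Definition swap_plan : {measure set (X * Y)%type -> \bar R} :=
  measure_function_pushforward__canonical__measure_function_Measure
    (P \x Q)%E measurable_swap_pair.

Lemma swap_plan_fst A : measurable A ->
  swap_plan (A `*` setT) = (P (A `*` setT) * Q setT)%E.
Proof.
move=> mA; rewrite /swap_plan/= /pushforward.
rewrite -product_measure1E//; last exact: measurableX.
congr ((P \x Q)%E _); apply/seteqP.
by split => -[[x y] [x' y']] /=; case=> // -[].
Qed.

Lemma swap_plan_snd B : measurable B ->
  swap_plan (setT `*` B) = (P setT * Q (setT `*` B))%E.
Proof.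
move=> mB; rewrite /swap_plan/= /pushforward.
rewrite -product_measure1E//; last exact: measurableX.
congr ((P \x Q)%E _); apply/seteqP.
by split => -[[x y] [x' y']] /=; case=> // ? [].
Qed.

Lemma swap_plan_integral_le (SP SQ : set (X * Y)%type) (f : X * Y -> R)
    (al : R) :
  measurable SP -> measurable SQ -> P (~` SP) = 0%E -> Q (~` SQ) = 0%E ->
  measurable_fun setT f -> (forall z, 0 <= f z) -> 0 <= al ->
  (forall p q, SP p -> SQ q -> f (p.1, q.2) <= al) ->
  (\int[swap_plan]_z (f z)%:E <= al%:E * (P setT * Q setT))%E.
Proof.
move=> mSP mSQ P0 Q0 mf f0 al0 fal.
rewrite (@ge0_integral_pushforward _ _ _ _ _ _ measurable_swap_pair
  (P \x Q)%E setT (EFin \o f))//; last 2 first.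
- exact/measurable_EFinP.
- by move=> z _; rewrite /= lee_fin.
rewrite -product_measure1E// setXTT -integral_cst// preimage_setT.
apply: ae_ge0_le_integral => //.
- by move=> z _; rewrite /= lee_fin.
- apply/measurable_EFinP; exact: measurableT_comp measurable_swap_pair.
have n1 : (P \x Q)%E.-negligible (~` SP `*` setT).
  exists (~` SP `*` setT); split => //.
    by apply: measurableX => //; exact: measurableC.
  transitivity (P (~` SP) * Q setT)%E; last by rewrite P0 mul0e.
  by apply: product_measure1E => //; exact: measurableC.
have n2 : (P \x Q)%E.-negligible (setT `*` ~` SQ).
  exists (setT `*` ~` SQ); split => //.
    by apply: measurableX => //; exact: measurableC.
  transitivity (P setT * Q (~` SQ))%E; last by rewrite Q0 mule0.
  by apply: product_measure1E => //; exact: measurableC.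
apply: negligibleS (negligibleU n1 n2) => -[p q] /= H.
apply: contrapT => /not_orP[h1 h2]; apply: H => _.
by apply: fal; apply: contrapT => h; [apply: h1|apply: h2].
Qed.

End swap_plan.

Section bounded_support.
Context {R : realType} {d : nat} (k : nat).
Notation Rd := 'rV[R]_d.
Notation leb := (@lebesgue_rV R d).

(** A class stable under sums and products and contained in the integrable functions. All terms of
    the first variation lie in it. *)
Definition bounded_supp (f : Rd -> R) : Prop :=
  measurable_fun setT f /\
  exists2 C, 0 <= C & forall y, `|f y| <= C * \1_(cube k) y.

Lemma bounded_suppZ c f : bounded_supp f -> bounded_supp (fun y => c * f y).
Proof.
move=> [mf [C C0 HC]]; split; first exact: measurable_funM.
exists (`|c| * C) => [|y]; first exact: mulr_ge0.
by rewrite normrM -mulrA ler_wpM2l.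
Qed.

Lemma bounded_suppD f1 f2 : bounded_supp f1 -> bounded_supp f2 ->
  bounded_supp (fun y => f1 y + f2 y).
Proof.
move=> [m1 [C1 C10 H1]] [m2 [C2 C20 H2]]; split; first exact: measurable_funD.
exists (C1 + C2) => [|y]; first exact: addr_ge0.
by rewrite mulrDl (le_trans (ler_normD _ _))// lerD.
Qed.

Lemma bounded_supp_sum (J : Type) (s : seq J) (F : J -> Rd -> R) :
  (forall j, bounded_supp (F j)) -> bounded_supp (fun y => \sum_(j <- s) F j y).
Proof.
move=> HF; elim: s => [|j s IH].
  under eq_fun do rewrite big_nil; split => //.
  by exists 0 => // y; rewrite normr0 mul0r.
by under eq_fun do rewrite big_cons; exact: bounded_suppD.
Qed.

Lemma bounded_suppM f1 f2 : bounded_supp f1 -> bounded_supp f2 ->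
  bounded_supp (fun y => f1 y * f2 y).
Proof.
move=> [m1 [C1 C10 H1]] [m2 [C2 C20 H2]]; split; first exact: measurable_funM.
exists (C1 * C2) => [|y]; first exact: mulr_ge0.
rewrite normrM; apply: (le_trans (ler_pM _ _ (H1 y) (H2 y))) => //.
by rewrite indicE; case: (_ \in _); rewrite ?mulr1 ?mulr0.
Qed.

Lemma bounded_supp_integrable f : bounded_supp f -> integrableR leb f.
Proof.
move=> [mf [C C0 HC]]; apply: integrable_le HC _ => //.
apply: integrable_indicM; first exact: measurable_cube.
exact: lebesgue_cube_lty.
Qed.

End bounded_support.

Lemma addIe_fin (R : realType) (x y s : \bar R) : s \is a fin_num ->
  (x + s = y + s)%E -> x = y.
Proof. by move=> fs E; rewrite -(addeK x fs) E addeK. Qed.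

(** * First variation along a cycle *)

(* Step [i] takes mass of the plan in layer [g i] near [S i], sends it to the
   targets of [S i.+1] and moves it there from layer [g i] to layer [g i.+1],
   where it replaces the mass taken at step [i.+1]. *)
Section cyclic_perturbation.
Context {R : realType} {d : nat} {G : finType}.
Notation Rd := 'rV[R]_d.
Notation leb := (@lebesgue_rV R d).
Variables (K : G -> G -> R) (tau : R) (W : Rd -> R).
Hypothesis K_ge0 : forall g g', 0 <= K g g'.
Hypothesis K_sym : forall g g', K g g' = K g' g.
Hypothesis tau_gt0 : 0 < tau.
Hypothesis mW : measurable_fun setT W.
Variables (mu sigma : G -> {finite_measure set Rd -> \bar R}).
Hypothesis mu_P2 : P2 mu.
Hypothesis sigma_P2 : P2 sigma.
Hypothesis sigma_ac : abs_cont sigma.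

Local Notation c := (@cost R d tau).
Local Notation ADM := (ADM K W tau mu sigma).
Local Notation exchange := (exchange K W tau).
Local Notation target_density := (target_density K tau W sigma).
Local Notation energy := (energy_density K W).

Variables (gamma : G -> {measure set (Rd * Rd) -> \bar R}).
Variables (h : G -> G -> Rd -> R).
Hypothesis adm : ADM gamma h.

(** [E i] contains the targets of [S i], and there all data are bounded. Per unit of mass, [al i]
    bounds the new transport cost from above, [be i] the old one from below, and [th i] the marginal
    cost of the change of layer from above. *)
Variables (N : nat) (g : nat -> G) (S : nat -> set (Rd * Rd))
  (E : nat -> set Rd) (al be th : nat -> R) (M : R) (k : nat).
Hypothesis gN : g N = g 0.
Hypothesis SN : S N = S 0.
Hypothesis adj : forall i, g i = g i.+1 \/ 0 < K (g i) (g i.+1).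
Hypothesis mS : forall i, measurable (S i).
Hypothesis mE : forall i, measurable (E i).
Hypothesis S_pos : forall i, (0 < gamma (g i) (S i))%E.
Hypothesis SE : forall i p, S i p -> E i p.2.
Hypothesis M_ge0 : 0 <= M.
Hypothesis E_cube : forall i, E i `<=` cube k.
Hypothesis E_density : forall i y, E i y -> target_density h (g i) y <= M.
Hypothesis E_W : forall i y, E i y -> W y <= M.
Hypothesis E_h : forall i a b y, E i y -> `|h a b y| <= M.
Hypothesis S_al : forall i p q, S i p -> S i.+1 q -> c p.1 q.2 <= al i.
Hypothesis S_be : forall i p, S i p -> be i <= c p.1 p.2.
Hypothesis E_th : forall i y, E i.+1 y -> h (g i) (g i.+1) y <= th i.

Let mh a b : measurable_fun setT (h a b). Proof. by case: adm. Qed.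
Let ha a b y : h a b y = - h b a y.
Proof. by case: adm => _ _ H _ _; exact: H. Qed.


Let S_lty i : (gamma (g i) (S i) < +oo)%E.
Proof. by rewrite (le_lt_trans _ (adm_lty adm (g i)))// le_measure ?inE. Qed.

Let m i := fine (gamma (g i) (S i)).

Let mEE i : gamma (g i) (S i) = (m i)%:E.
Proof. by rewrite fineK// ge0_fin_numE. Qed.

Let m_gt0 i : 0 < m i. Proof. by rewrite -lte_fin -mEE. Qed.

Let mN : m N = m 0. Proof. by rewrite /m gN SN. Qed.

Let P i : {finite_measure set (Rd * Rd)%type -> \bar R} :=
  mfrestr (mS i) (S_lty i).

Let PE i X : P i X = gamma (g i) (X `&` S i). Proof. by []. Qed.

Let PT i : P i setT = (m i)%:E. Proof. by rewrite PE setTI mEE. Qed.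

Let PC i : P i (~` S i) = 0%E. Proof. by rewrite PE setICl measure0. Qed.

Let V i : {measure set Rd -> \bar R} := snd_marginal (P i).

Let VE i A : V i A = P i (setT `*` A). Proof. by rewrite setTX. Qed.

(** The mass taken at step [i] is part of [gamma (g i)] with targets in [E i], where the density of
    the second marginal is at most [M]. *)
Let V_bound i A : measurable A -> (V i A <= M%:E * leb (A `&` E i))%E.
Proof.
move=> mA; have mAE : measurable (A `&` E i) by exact: measurableI.
apply: (@le_trans _ _ (snd_marginal (gamma (g i)) (A `&` E i))).
  rewrite VE PE; apply: le_measure; rewrite ?inE.
  - by apply: measurableI => //; exact: measurableX.
  - rewrite -[X in measurable X]setTI; exact: measurable_snd.
  - by move=> [x y] /= [[_ Ay] Sxy]; split => //; exact: SE Sxy.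
rewrite (snd_marginal_density mW sigma_ac adm)//.
rewrite -integral_cst//; apply: le_integral => //.
- apply: integrableS (target_density_integrable mW sigma_ac adm (g i)) => //.
- apply: measurable_bounded_integrable => //; last exact: bounded_cst.
  by apply: (@lebesgue_sub_cube_lty _ _ _ k) => // y [_ /E_cube].
- by move=> y; rewrite inE => -[_ Ey]; rewrite lee_fin; exact: E_density.
Qed.

Let v_exists i : exists v : Rd -> R, [/\ measurable_fun setT v,
  forall y, 0 <= v y <= M * \1_(E i) y &
  forall A, measurable A -> V i A = (\int[leb]_(y in A) (v y)%:E)%E].
Proof.
apply: bounded_density_exists => //; last exact: V_bound.
exact: (@lebesgue_sub_cube_lty _ _ _ k).
Qed.

Let v i : Rd -> R := sval (cid (v_exists i)).

Let mv i : measurable_fun setT (v i).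
Proof. by rewrite /v; case: cid => ? /= []. Qed.

Let v_ge0 i y : 0 <= v i y.
Proof. by rewrite /v; case: cid => u /= [_ H _]; case/andP: (H y). Qed.

Let v_le i y : v i y <= M * \1_(E i) y.
Proof. by rewrite /v; case: cid => u /= [_ H _]; case/andP: (H y). Qed.

Let v_int i A : measurable A -> V i A = (\int[leb]_(y in A) (v i y)%:E)%E.
Proof. by rewrite /v; case: cid => u /= [_ _]; apply. Qed.

Let v_off i y : ~ E i y -> v i y = 0.
Proof.
move=> nE; apply/le_anti; rewrite v_ge0 andbT (le_trans (v_le i y))//.
by rewrite indicE memNset// mulr0.
Qed.

Let bounded_supp_v i (f : Rd -> R) C : 0 <= C -> measurable_fun setT f ->
  (forall y, E i y -> `|f y| <= C) -> bounded_supp k (fun y => f y * v i y).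
Proof.
move=> C0 mf HC; split; first exact: measurable_funM.
exists (C * M) => [|y]; first exact: mulr_ge0.
have [Ey|nE] := pselect (E i y); last first.
  by rewrite v_off// mulr0 normr0 !mulr_ge0// indicE.
rewrite indicE (mem_set (E_cube Ey)) mulr1 normrM ler_pM//; first exact: HC.
by rewrite ger0_norm// (le_trans (v_le i y))// indicE mem_set// mulr1.
Qed.

Let bounded_supp_v1 i : bounded_supp k (v i).
Proof.
have := @bounded_supp_v i (cst 1) 1 ler01 (measurable_cst _).
under eq_fun do rewrite mul1r; apply => y _; by rewrite normr1.
Qed.

Let bounded_supp_vW i : bounded_supp k (fun y => expR (W y) * v i y).
Proof.
apply: (@bounded_supp_v i _ (expR M)); first exact: expR_ge0.
  exact: measurableT_comp.
by move=> y Ey; rewrite ger0_norm ?expR_ge0// ler_expR; exact: E_W Ey.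
Qed.

Let bounded_supp_vh i a b : bounded_supp k (fun y => h a b y * v i y).
Proof. by apply: (@bounded_supp_v i _ M) => // y Ey; exact: E_h Ey. Qed.

Let v_mass i : \int[leb]_y v i y = m i.
Proof.
by rewrite /Rintegral -v_int// VE PE setXTT setTI.
Qed.

Let Vr i A := fine (V i A).

Let VrE i A : measurable A -> V i A = (Vr i A)%:E.
Proof.
move=> mA; rewrite /Vr fineK// ge0_fin_numE//.
by apply: (le_lt_trans (V_bound i mA)); rewrite lte_mul_pinfty//;
  apply: (@lebesgue_sub_cube_lty _ _ _ k);
    [exact: measurableI|move=> y [_ /E_cube]].
Qed.

Let VrN A : Vr N A = Vr 0 A.
Proof. by rewrite /Vr !VE !PE gN SN. Qed.

(* Signed number of times step [i] of the cycle uses the edge [a -> b]. *)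
Let fl i a b : R := ((g i == a) && (g i.+1 == b))%:R -
  ((g i == b) && (g i.+1 == a))%:R.

Let flC i a b : fl i a b = - fl i b a.
Proof. by rewrite /fl opprB. Qed.

(** A step either stays in its layer, where the two indicators cancel, or follows an edge with
    positive [K]. Hence the division by [K a b] in [kk] is harmless. *)
Let fl0 i a b : K a b = 0 -> fl i a b = 0.
Proof.
move=> K0; rewrite /fl; case: (adj i) => [<-|Ki]; first by rewrite andbC subrr.
have nab x y : K x y = 0 -> (g i == x) && (g i.+1 == y) = false.
  move=> Kxy; apply/negP => /andP[/eqP ix /eqP iy].
  by move: Ki; rewrite ix iy Kxy ltxx.
by rewrite !nab ?subrr// K_sym.
Qed.

Let sum_ind (x : G) : \sum_b (x == b)%:R = 1 :> R.
Proof.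
by rewrite (bigD1 x)//= eqxx big1 ?addr0// => b /negbTE; rewrite eq_sym => ->.
Qed.

Let fl_sum i a : \sum_b fl i a b = (g i == a)%:R - (g i.+1 == a)%:R.
Proof.
rewrite /fl sumrB; congr (_ - _).
  under eq_bigr do rewrite -mulnb natrM.
  by rewrite -mulr_sumr sum_ind mulr1.
under eq_bigr do rewrite -mulnb natrM.
by rewrite -mulr_suml sum_ind mul1r.
Qed.

(* The factor [expR (W y) / (tau * K a b)] makes the mass exchanged along
   [a -> b] under [kk] equal to the transported density [v i.+1 / m i.+1]. *)
Let kk a b (y : Rd) : R :=
  \sum_(i < N) (fl i a b / (tau * K a b * m i.+1)) * (expR (W y) * v i.+1 y).

Let kkC a b y : kk a b y = - kk b a y.
Proof.
rewrite /kk -sumrN; apply: eq_bigr => i _.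
by rewrite (flC i a b) (K_sym a b) !mulNr.
Qed.

Let bounded_supp_kk a b : bounded_supp k (kk a b).
Proof.
by apply: bounded_supp_sum => i; apply: bounded_suppZ; exact: bounded_supp_vW.
Qed.

Let flux a b y : kk a b y * K a b * expR (- W y) =
  \sum_(i < N) (fl i a b / (tau * m i.+1)) * v i.+1 y.
Proof.
rewrite /kk !mulr_suml; apply: eq_bigr => i _.
have [K0|K0] := eqVneq (K a b) 0.
  by rewrite (fl0 i K0) !mul0r.
have m0 : m i.+1 != 0 by rewrite gt_eqF.
have t0 : tau != 0 by rewrite gt_eqF.
have eW : expR (- W y) * expR (W y) = 1 by rewrite -expRD addNr expR0.
rewrite -[RHS]mulr1 -eW; field.
by rewrite K0 m0 t0.
Qed.

Let bounded_supp_flux a b :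
  bounded_supp k (fun y => kk a b y * K a b * expR (- W y)).
Proof.
under eq_fun do rewrite flux.
by apply: bounded_supp_sum => i; apply: bounded_suppZ.
Qed.

(** Layer [a] gives up the normalised density of step [i] if [a = g i] and receives it if
    [a = g i.+1]. *)
Let pert a y : R := \sum_(i < N)
  (((g i == a)%:R - (g i.+1 == a)%:R) / m i.+1) * v i.+1 y.

Let exchange_kk a y : exchange kk a y = pert a y.
Proof.
rewrite /Defs.exchange; under eq_bigr do rewrite flux.
rewrite exchange_big/= mulr_sumr; apply: eq_bigr => i _.
rewrite -mulr_suml -mulr_suml fl_sum mulrA; congr (_ * _).
have m0 : m i.+1 != 0 by rewrite gt_eqF.
have t0 : tau != 0 by rewrite gt_eqF.
by field; rewrite m0 t0.
Qed.

Let cross y := \sum_a \sum_b h a b y * kk a b y * K a b * expR (- W y).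

(** The factor in [kk] cancels the weight of the energy. Both orientations of an edge contribute
    equally, [h] and [kk] being antisymmetric, whence the factor 2. *)
Let crossE y : cross y =
  \sum_(i < N) (2 / (tau * m i.+1)) * (h (g i) (g i.+1) y * v i.+1 y).
Proof.
have -> : cross y = \sum_(i < N) \sum_a \sum_b
    (fl i a b * h a b y) * (v i.+1 y / (tau * m i.+1)).
  rewrite /cross; rewrite exchange_big/=.
  under eq_bigr => b _.
    under eq_bigr => a _.
      rewrite -!mulrA (mulrA (kk a b y)) flux mulr_sumr; over.
    over.
  rewrite exchange_big/=.
  under eq_bigr => a _ do rewrite exchange_big/=.
  rewrite exchange_big/=; apply: eq_bigr => i _.
  by apply: eq_bigr => a _; apply: eq_bigr => b _; ring.
apply: eq_bigr => i _.
have -> : \sum_a \sum_b fl i a b * h a b y * (v i.+1 y / (tau * m i.+1)) =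
    (\sum_a \sum_b fl i a b * h a b y) * (v i.+1 y / (tau * m i.+1)).
  by rewrite mulr_suml; apply: eq_bigr => a _; rewrite mulr_suml.
have ind2 x x' : \sum_a \sum_b ((x == a) && (x' == b))%:R * h a b y = h x x' y.
  rewrite (bigD1 x)//= (bigD1 x')//= !eqxx mul1r big1 ?addr0; last first.
    by move=> b /negbTE; rewrite eq_sym => ->; rewrite mul0r.
  rewrite big1 ?addr0// => a /negbTE; rewrite eq_sym => ->.
  by rewrite big1// => b _; rewrite mul0r.
have -> : \sum_a \sum_b fl i a b * h a b y =
    h (g i) (g i.+1) y - h (g i.+1) (g i) y.
  rewrite -{1}(ind2 (g i) (g i.+1)) -(ind2 (g i.+1) (g i)) -sumrB.
  apply: eq_bigr => a _; rewrite -sumrB; apply: eq_bigr => b _.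
  by rewrite /fl mulrBl; congr (_ - _ * _); rewrite andbC.
rewrite (ha (g i.+1) (g i)) opprK -mulr2n; ring.
Qed.

Let bounded_supp_cross : bounded_supp k cross.
Proof.
rewrite (_ : cross = fun y => \sum_(i < N)
    (2 / (tau * m i.+1)) * (h (g i) (g i.+1) y * v i.+1 y)).
  by apply: bounded_supp_sum => i; apply: bounded_suppZ; exact: bounded_supp_vh.
by apply/funext => y; rewrite crossE.
Qed.

Let cross_int : tau / 2 * \int[leb]_y cross y <= \sum_(i < N) th i.
Proof.
have it (i : 'I_N) : integrableR leb
    (fun y => (2 / (tau * m i.+1)) * (h (g i) (g i.+1) y * v i.+1 y)).
  apply: bounded_supp_integrable; apply: bounded_suppZ.
  exact: bounded_supp_vh.
under eq_Rintegral do rewrite crossE.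
rewrite (Rintegral_sum _ it) mulr_sumr; apply: ler_sum => i _.
rewrite RintegralZl//; last exact/bounded_supp_integrable/bounded_supp_vh.
have m0 := m_gt0 i.+1.
rewrite (_ : _ * _ = (m i.+1)^-1 * \int[leb]_y (h (g i) (g i.+1) y * v i.+1 y));
  last by field; rewrite !gt_eqF.
rewrite ler_pdivrMl// mulrC -v_mass -RintegralZl//; last first.
  exact: bounded_supp_integrable.
apply: Rintegral_ae_le.
- exact/bounded_supp_integrable/bounded_supp_vh.
- by apply/bounded_supp_integrable/bounded_suppZ.
apply/aeW => y; have [Ey|nE] := pselect (E i.+1 y).
  by rewrite ler_wpM2r//; exact: E_th.
by rewrite v_off// !mulr0.
Qed.

Let bounded_supp_ekk : bounded_supp k (energy kk).
Proof.
rewrite /energy_density.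
apply: bounded_supp_sum => a; apply: bounded_supp_sum => b.
rewrite (_ : (fun y => _) =
  fun y => kk a b y * (kk a b y * K a b * expR (- W y))).
  by apply: bounded_suppM; [exact: bounded_supp_kk|exact: bounded_supp_flux].
by apply/funext => y; ring.
Qed.

Section time.
Variable t : R.
Hypothesis t_gt0 : 0 < t.
(** [t] is the mass moved at every step, that is the fraction [t / m i] of the mass of [S i]. The
    sets [S i] may overlap, so it is the sum of the fractions that has to be at most 1. *)
Hypothesis t_small : \sum_(i < N) t / m i <= 1.

Let ht a b y := h a b y + t * kk a b y.

Let mht a b : measurable_fun setT (ht a b).
Proof.
apply: measurable_funD => //; apply: measurable_funM => //.
by case: (bounded_supp_kk a b).
Qed.

Let energy_ht y : energy ht y =
  energy h y + (2 * t * cross y + t ^+ 2 * energy kk y).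
Proof.
rewrite /energy_density /cross !mulr_sumr -!big_split/=.
apply: eq_bigr => a _; rewrite !mulr_sumr -!big_split/=.
by apply: eq_bigr => b _; rewrite /ht; ring.
Qed.

Let energy_ht_integrable : integrableR leb (energy ht).
Proof.
have := energy_density_integrable K_ge0 mW adm => ie.
rewrite (_ : energy ht = fun y => energy h y +
    (2 * t * cross y + t ^+ 2 * energy kk y)).
  apply: integrableRD => //; apply: integrableRD; apply: integrableRZ.
    exact: bounded_supp_integrable bounded_supp_cross.
  exact: bounded_supp_integrable bounded_supp_ekk.
by apply/funext => y; exact: energy_ht.
Qed.

Let energy_ht_int : \int[leb]_y energy ht y =
  \int[leb]_y energy h y +
  (2 * t * \int[leb]_y cross y + t ^+ 2 * \int[leb]_y energy kk y).
Proof.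
have ie := energy_density_integrable K_ge0 mW adm.
have ic := bounded_supp_integrable bounded_supp_cross.
have ik := bounded_supp_integrable bounded_supp_ekk.
under eq_Rintegral do rewrite energy_ht.
rewrite RintegralD//; last by apply: integrableRD; exact: integrableRZ.
congr (_ + _); rewrite RintegralD//; [|exact: integrableRZ..].
by rewrite !RintegralZl.
Qed.

Let exchange_ht a y : exchange ht a y = exchange h a y + t * pert a y.
Proof.
rewrite -exchange_kk /Defs.exchange mulrCA -mulrDr; congr (_ * _).
rewrite mulr_sumr -big_split/=; apply: eq_bigr => b _.
by rewrite /ht; ring.
Qed.

Let pert_int a A : measurable A -> (\int[leb]_(y in A) (pert a y)%:E =
  (\sum_(i < N)
    (((g i == a)%:R - (g i.+1 == a)%:R) / m i.+1) * Vr i.+1 A)%:E)%E.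
Proof.
move=> mA; have iv i : leb.-integrable A (EFin \o v i).
  by apply: integrableS (bounded_supp_integrable (bounded_supp_v1 i)).
under eq_integral do rewrite -sumEFin.
under eq_integral do under eq_bigr do rewrite EFinM.
rewrite (integral_sum mA); last first.
  by move=> i; apply: integrableZl => //; exact: iv.
rewrite -sumEFin; apply: eq_bigr => i _.
by rewrite [in RHS]EFinM -VrE// v_int//; exact: (integralZl mA (iv i.+1)).
Qed.

(** Dividing by the mass of [P i.+1] gives the same first marginal as [P i], so that replacing one
    by the other preserves the sources. *)
Let lam i : {measure set (Rd * Rd)%type -> \bar R} :=
  mscale (NngNum (ltW (divr_gt0 ltr01 (m_gt0 i.+1))))
    (swap_plan (P i) (P i.+1)).

Let lamE i X : lam i X = ((1 / m i.+1)%:E * swap_plan (P i) (P i.+1) X)%E.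
Proof. by []. Qed.

Let lam_fst i A : measurable A ->
  lam i (A `*` setT) = gamma (g i) (S i `&` (A `*` setT)).
Proof.
move=> mA; rewrite lamE swap_plan_fst// [X in (_ * X)%E]muleC muleA PT.
rewrite -EFinM mul1r mulVf ?gt_eqF// mul1e PE setIC//.
Qed.

Let lam_snd i A : measurable A ->
  lam i (setT `*` A) = (m i / m i.+1 * Vr i.+1 A)%:E.
Proof.
move=> mA; rewrite lamE swap_plan_snd// PT -VE VrE// -!EFinM; congr EFin.
by ring.
Qed.

Let lam_cost i : (\int[lam i]_p (c p.1 p.2)%:E <= (al i * m i)%:E)%E.
Proof.
have mc := @measurable_cost R d tau.
have c0 (p : Rd * Rd) : 0 <= c p.1 p.2 by exact: cost_ge0.
rewrite ge0_integral_mscale//; last 2 first.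
- exact/measurable_EFinP.
- by move=> p _; rewrite lee_fin.
have neS j : S j !=set0.
  apply/set0P/eqP => Sj0; have := S_pos j; rewrite Sj0 measure0 ltxx//.
have al0 : 0 <= al i.
  have [p Sp] := neS i; have [q Sq] := neS i.+1.
  exact: le_trans (cost_ge0 tau_gt0 _ _) (S_al Sp Sq).
have H : (\int[swap_plan (P i) (P i.+1)]_p (c p.1 p.2)%:E <=
    (al i)%:E * (P i setT * P i.+1 setT))%E.
  apply: (@swap_plan_integral_le _ _ _ _ _ _ _ (S i) (S i.+1)
    (fun p => c p.1 p.2)) => //.
  by move=> p q Sp Sq; exact: S_al Sp Sq.
apply: (le_trans (lee_wpmul2l _ H)).
  by rewrite lee_fin divr_ge0// ltW.
rewrite !PT -!EFinM lee_fin.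
change (1 / m i.+1 * (al i * (m i * m i.+1)) <= al i * m i).
rewrite (_ : 1 / m i.+1 * _ = al i * m i)//.
by field; rewrite gt_eqF.
Qed.

Let wt a i : R := (g i == a)%:R * (t / m i).

Let wt_ge0 a i : 0 <= wt a i.
Proof. by rewrite mulr_ge0// divr_ge0// ltW. Qed.

Let wt_sum a : \sum_(i < N) wt a i <= 1.
Proof.
apply: le_trans t_small; apply: ler_sum => i _.
rewrite /wt ler_piMl//; first by apply: divr_ge0; exact: ltW.
by case: (_ == _); rewrite ?lexx ?ler01.
Qed.

Let competitor_exists :
  exists gamma' : G -> {measure set (Rd * Rd)%type -> \bar R},
  forall a, (forall X, measurable X ->
      (gamma' a X + \sum_(i < N) (wt a i)%:E * gamma a (S i `&` X) =
       gamma a X + \sum_(i < N) (wt a i)%:E * lam i X)%E) /\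
    (forall f : Rd * Rd -> R, measurable_fun setT f -> (forall x, 0 <= f x) ->
      (\int[gamma' a]_x (f x)%:E +
         \sum_(i < N) (wt a i)%:E * \int[gamma a]_(x in S i) (f x)%:E =
       \int[gamma a]_x (f x)%:E +
         \sum_(i < N) (wt a i)%:E * \int[lam i]_x (f x)%:E)%E).
Proof.
have [f Hf] := choice (fun a =>
  measure_replace lam (adm_lty adm a) (wt_ge0 a) (wt_sum a) mS).
by exists f.
Qed.

Lemma cyclic_competitor : exists2 gamma', ADM gamma' ht &
  (total_cost K W tau gamma' ht <= total_cost K W tau gamma h +
   (t * \sum_(i < N) (al i - be i + th i) +
    t ^+ 2 * (tau / 4 * \int[leb]_y energy kk y))%:E)%E.
Proof.
have [gamma' Hg] := competitor_exists.
have gfin a X : measurable X -> gamma a X \is a fin_num.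
  move=> mX; rewrite ge0_fin_numE// (le_lt_trans _ (adm_lty adm a))//.
  by rewrite le_measure ?inE.
have Sfin a X : measurable X ->
    (\sum_(i < N) (wt a i)%:E * gamma a (S i `&` X))%E \is a fin_num.
  move=> mX; apply/sum_fin_numP => i _ _; rewrite fin_numM// gfin//.
  exact: measurableI.
have wt_if a i x : ((wt a i)%:E * x =
    if g i == a then (t / m i)%:E * x else 0)%E.
  by rewrite /wt; case: eqP => _; rewrite ?mul1r ?mul0r ?mul0e.
have adm' : ADM gamma' ht.
  split.
  - move=> a A mA; case: (adm) => H _ _ _ _; rewrite -H//.
    have mAT : measurable (A `*` [set: Rd]) by exact: measurableX.
    have [/(_ _ mAT) e _] := Hg a; apply: (addIe_fin (Sfin a _ mAT)).
    rewrite e; congr (_ + _)%E; apply: eq_bigr => i _; rewrite !wt_if.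
    by case: eqP => // <-; rewrite lam_fst.
  - exact: mht.
  - by move=> a b y; rewrite /ht (ha a b) (kkC a b); ring.
  - by rewrite h_energyE// integrable_lty.
  - move=> a A mA.
    have mTA : measurable ([set: Rd] `*` A) by exact: measurableX.
    case: (adm) => _ _ _ _ /(_ a A mA) sE.
    have [/(_ _ mTA) e _] := Hg a.
    have iex := exchange_integrable mW adm a.
    have ipert : integrableR leb (fun y => t * pert a y).
      apply/integrableRZ/bounded_supp_integrable.
      by apply: bounded_supp_sum => i; exact: bounded_suppZ.
    have -> : (\int[leb]_(y in A) (exchange ht a y)%:E =
        \int[leb]_(y in A) (exchange h a y)%:E + t%:E *
        \int[leb]_(y in A) (pert a y)%:E)%E.
      under eq_integral do rewrite exchange_ht.
      rewrite integralD_EFin//; last 2 first.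
      + exact: integrableS iex.
      + exact: integrableS ipert.
      congr (_ + _)%E; have hi : leb.-integrable A (EFin \o pert a).
        apply: (@integrableS _ _ _ _ setT) => //.
        apply: bounded_supp_integrable.
        by apply: bounded_supp_sum => i; exact: bounded_suppZ.
      exact: (integralZl mA hi t).
    have gV i : gamma (g i) (S i `&` ([set: Rd] `*` A)) = (Vr i A)%:E.
      by rewrite -VrE// VE PE setIC.
    have e1 : (\sum_(i < N) (wt a i)%:E * gamma a (S i `&` ([set: Rd] `*` A)) =
        (\sum_(i < N) (g i == a)%:R * (t / m i * Vr i A))%:E)%E.
      rewrite -sumEFin; apply: eq_bigr => i _; rewrite wt_if.
      by case: eqP => [<-|_]; rewrite ?gV ?mul1r ?mul0r.
    have e2 : (\sum_(i < N) (wt a i)%:E * lam i ([set: Rd] `*` A) =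
        (\sum_(i < N) (g i == a)%:R * (t / m i.+1 * Vr i.+1 A))%:E)%E.
      rewrite -sumEFin; apply: eq_bigr => i _; rewrite lam_snd// -EFinM.
      congr EFin; rewrite /wt; field; rewrite !gt_eqF//.
    (* Reindexing along the cycle, which closes because the terms for [N] and 0 agree. *)
    have shift : \sum_(i < N) (g i.+1 == a)%:R * (t / m i.+1 * Vr i.+1 A) =
        \sum_(i < N) (g i == a)%:R * (t / m i * Vr i A).
      pose T i := (g i == a)%:R * (t / m i * Vr i A).
      have TN : T N = T 0 by rewrite /T gN mN VrN.
      apply: (@addrI _ (T 0)); rewrite -[LHS](big_ord_recl N (fun i => T i)).
      by rewrite big_ord_recr/= TN addrC.
    (* The second marginal changes by exactly the change of the exchange term, so the target [sigma]
       is unchanged. *)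
    have gS : gamma' a ([set: Rd] `*` A) =
        (gamma a ([set: Rd] `*` A) + t%:E * \int[leb]_(y in A) (pert a y)%:E)%E.
      apply: (addIe_fin (Sfin a _ mTA)); rewrite e e1 e2 pert_int//.
      rewrite -!addeA -!EFinM -!EFinD; congr (_ + _%:E)%E.
      rewrite -shift mulr_sumr -big_split/=; apply: eq_bigr => i _; ring.
    rewrite gS sE oppeD; last first.
      by rewrite fin_num_adde_defr// (adm_exchange_fin adm).
    rewrite addeACA -[LHS]adde0; congr (_ + _)%E; rewrite subee//.
    by rewrite pert_int// -EFinM.
exists gamma' => //.
rewrite (total_costE K_ge0 K_sym tau_gt0 mW mu_P2 sigma_P2 sigma_ac adm).
rewrite (total_costE K_ge0 K_sym tau_gt0 mW mu_P2 sigma_P2 sigma_ac adm').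
have ci a := adm_cost_integrable K_sym tau_gt0 mW mu_P2 sigma_P2 sigma_ac adm a.
have ci' a := adm_cost_integrable K_sym tau_gt0 mW mu_P2 sigma_P2 sigma_ac
  adm' a.
have mc := @measurable_cost R d tau.
have c0 (p : Rd * Rd) : 0 <= c p.1 p.2 by exact: cost_ge0.
(* Each step removes mass [t] of cost at least [be i] per unit and inserts mass [t] of cost at most
   [al i] per unit. *)
have bound a : \int[gamma' a]_p c p.1 p.2 <= \int[gamma a]_p c p.1 p.2 +
    \sum_(i < N) (g i == a)%:R * (t * (al i - be i)).
  have [_ /(_ _ mc c0)] := Hg a; rewrite !RintegralE//.
  have lamc i : (\int[lam i]_p (c p.1 p.2)%:E =
      (\int[lam i]_p c p.1 p.2)%:E)%E.
    rewrite fineK// ge0_fin_numE; last first.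
      by apply: integral_ge0 => p _; rewrite lee_fin.
    by rewrite (le_lt_trans (lam_cost i))// ltry.
  have ciS i : (\int[gamma a]_(p in S i) (c p.1 p.2)%:E =
      (\int[gamma a]_(p in S i) c p.1 p.2)%:E)%E.
    rewrite fineK//; apply: integrable_fin_num => //.
    exact: integrableS (ci a).
  under eq_bigr do rewrite ciS -EFinM.
  under [in RHS]eq_bigr do rewrite lamc -EFinM.
  rewrite !sumEFin -!EFinD => -[e].
  rewrite -(lerD2r (\sum_(i < N)
    wt a i * \int[gamma a]_(p in S i) c p.1 p.2)) e.
  rewrite -addrA lerD2l -big_split/=; apply: ler_sum => i _.
  rewrite /wt; case: eqP => [ia|_]; rewrite ?mul0r ?addr0// !mul1r.
  have H1 : \int[lam i]_p c p.1 p.2 <= al i * m i.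
    by rewrite -lee_fin -lamc; exact: lam_cost.
  have H2 : be i * m i <= \int[gamma a]_(p in S i) c p.1 p.2.
    rewrite -lee_fin -ciS -ia EFinM -mEE -integral_cst//.
    apply: le_integral => //.
    - apply: measurable_bounded_integrable => //; exact: bounded_cst.
    - by rewrite ia; exact: integrableS (ci a).
    - by move=> p; rewrite inE => Sp; rewrite lee_fin; exact: S_be.
  have mi := m_gt0 i; have tm : 0 <= t / m i by apply: divr_ge0; exact: ltW.
  have := ler_wpM2l tm H1; have := ler_wpM2l tm H2.
  rewrite (_ : t / m i * (be i * m i) = t * be i); last first.
    by field; rewrite gt_eqF.
  rewrite (_ : t / m i * (al i * m i) = t * al i); last first.
    by field; rewrite gt_eqF.
  by rewrite mulrBr; lra.
have sbound : \sum_a \int[gamma' a]_p c p.1 p.2 <=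
    \sum_a \int[gamma a]_p c p.1 p.2 + t * \sum_(i < N) (al i - be i).
  apply: (le_trans (ler_sum _ (fun a _ => bound a))).
  rewrite big_split/= lerD2l exchange_big/= mulr_sumr; apply: ler_sum => i _.
  by rewrite -mulr_suml sum_ind mul1r.
rewrite -EFinD lee_fin energy_ht_int.
have := cross_int; rewrite big_split/= [t * (_ + _)]mulrDr.
set X := \int[leb]_y cross y; set Y := \int[leb]_y energy kk y.
set I0 := \int[leb]_y energy h y => HX.
have : t * (tau / 2 * X) <= t * \sum_(i < N) th i by rewrite ler_wpM2l// ltW.
(* The linear term of the energy is [2 * t * X]; with the coefficient [tau / 4] it is what
   [cross_int] bounds by the [th i]. *)
rewrite [tau / 4 * (_ + _)](_ : _ =
  tau / 4 * I0 + t * (tau / 2 * X) + t ^+ 2 * (tau / 4 * Y)); last by field.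
by move: sbound; lra.
Qed.

End time.

(** The cost changes by at most [t * A + t^2 * Y], where [A] is the sum in question. If [A] were
    negative, a small [t] would contradict minimality. *)
Lemma cyclic_stationarity :
  (forall gamma' h', ADM gamma' h' ->
     (total_cost K W tau gamma h <= total_cost K W tau gamma' h')%E) ->
  0 <= \sum_(i < N) (al i - be i + th i).
Proof.
move=> hmin; rewrite leNgt; apply/negP; set A := \sum_(i < N) _ => A0.
pose Y := tau / 4 * \int[leb]_y energy kk y.
(* The summand 1 keeps [s0] positive even for [N = 0]. *)
pose s0 := 1 + \sum_(i < N) (m i)^-1.
have s00 : 0 < s0.
  by rewrite ltr_wpDr// sumr_ge0// => i _; rewrite invr_ge0 ltW.
have Y1 : 0 < 2 * (`|Y| + 1) by rewrite mulr_gt0// ltr_wpDl.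
(* The first bound keeps the removed fractions at most 1 in total; the second gives
   [t * Y <= - A / 2], hence [A + t * Y < 0]. *)
pose t := Num.min s0^-1 (- A / (2 * (`|Y| + 1))).
have t0 : 0 < t.
  by rewrite lt_min invr_gt0 s00/= divr_gt0// oppr_gt0.
have tsmall : \sum_(i < N) t / m i <= 1.
  rewrite -mulr_sumr; apply: (@le_trans _ _ (t * s0)).
    by apply: ler_wpM2l; [exact: ltW|rewrite /s0 lerDr].
  by rewrite -ler_pdivlMr// div1r ge_min lexx.
have [gamma' adm' le1] := cyclic_competitor t0 tsmall.
have := le_trans (hmin _ _ adm') le1.
rewrite (total_costE K_ge0 K_sym tau_gt0 mW mu_P2 sigma_P2 sigma_ac adm).
rewrite -EFinD lee_fin lerDl -/A -/Y expr2 -mulrA -mulrDr pmulr_rge0// => H.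
have tY : t * `|Y| <= - A / 2.
  apply: (@le_trans _ _ (t * (`|Y| + 1))).
    by apply: ler_wpM2l; [exact: ltW|rewrite lerDl].
  rewrite -ler_pdivlMr; last by rewrite ltr_wpDl.
  rewrite (_ : - A / 2 / (`|Y| + 1) = - A / (2 * (`|Y| + 1))).
    by rewrite ge_min lexx orbT.
  by rewrite invfM mulrA.
have := ler_wpM2l (ltW t0) (ler_norm Y); lra.
Qed.

End cyclic_perturbation.

(** * Transferring null sets between the plans and Lebesgue measure *)

Section measurable_bounded_below.
Context {R : realType} {d : nat}.
Notation Rd := 'rV[R]_d.
Variable tau : R.
Hypothesis tau_gt0 : 0 < tau.
Local Notation c := (@cost R d tau).

(** Being unbounded below is a countable intersection over [n] of conditions that are open because
    the cost is continuous. No countability of the family is required. *)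
Lemma measurable_bounded_below (J : Type) (P : set J) (xs : J -> Rd)
    (b : J -> R) :
  measurable [set y | exists M, forall p, P p -> M <= c (xs p) y - b p].
Proof.
pose O n := [set y | exists2 p, P p & c (xs p) y - b p < - n%:R].
rewrite [X in measurable X](_ : _ = ~` \bigcap_n O n).
  apply: measurableC; apply: bigcapT_measurable => n.
  apply: sub_sigma_algebra; rewrite /= openE => y [p Pp h].
  have e0 : 0 < - n%:R - (c (xs p) y - b p) by rewrite subr_gt0.
  have [t t0 Ht] := continuous_cost tau_gt0 (xs p) y e0.
  apply/nbhs_ballP; exists t => //= z [_ yz]; exists p => //.
  suff : `|c (xs p) z - c (xs p) y| < - n%:R - (c (xs p) y - b p).
    by rewrite ltr_distl => /andP[_]; lra.
  apply: Ht => i; first by rewrite subrr normr0.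
  by rewrite distrC; have := yz ord0 i.
apply/seteqP; split => y /=.
  move=> [M HM] H; have [p Pp h] := H (Num.bound `|M|) I.
  have := HM p Pp; have := archi_boundP (normr_ge0 M); have := ler_norm (- M).
  by rewrite normrN; lra.
move=> H; apply: contrapT => nM; apply: H => n _; apply: contrapT => nO.
apply: nM; exists (- n%:R) => p Pp; rewrite leNgt; apply/negP => h.
by apply: nO; exists p.
Qed.

End measurable_bounded_below.

Section positive_density.
Context d (T : measurableType d) (R : realType).
Variables (m nu : {measure set T -> \bar R}) (F : T -> R).
Hypothesis mF : measurable_fun setT F.
Hypothesis F_gt0 : {ae m, forall x, 0 < F x}.
Hypothesis nuF : forall A, measurable A -> nu A = (\int[m]_(x in A) (F x)%:E)%E.

(** The converse of absolute continuity; positivity of the densities enters through this lemma. *)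
Lemma positive_density_null A : measurable A -> nu A = 0%E -> m.-negligible A.
Proof.
move=> mA; rewrite nuF// => A0.
have mFA : measurable_fun A (EFin \o F).
  exact/measurable_EFinP/measurable_funTS.
have : (\int[m]_(x in A) `|(EFin \o F) x| = 0)%E.
  rewrite -A0; apply: ae_eq_integral => //; first exact: measurableT_comp.
  by apply: filterS F_gt0 => x Fx _; rewrite /= gtr0_norm.
move=> /(ae_eq_integral_abs m mA mFA) H.
apply: negligibleS (negligibleU F_gt0 H) => x Ax.
have [Fx|nFx] := pselect (0 < F x); [right|by left].
by move=> /(_ Ax) [] /eqP; rewrite gt_eqF.
Qed.

End positive_density.

(** * Potentials from shortest paths *)

Section necessity.
Context {R : realType} {d : nat} {G : finType}.
Notation Rd := 'rV[R]_d.
Notation leb := (@lebesgue_rV R d).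
Variables (K : G -> G -> R) (tau : R) (W : Rd -> R).
Hypothesis K_ge0 : forall g g', 0 <= K g g'.
Hypothesis K_sym : forall g g', K g g' = K g' g.
Hypothesis K_conn : forall g g', connect (fun a b => 0 < K a b) g g'.
Hypothesis tau_gt0 : 0 < tau.
Hypothesis mW : measurable_fun setT W.
Variables (mu sigma : G -> {finite_measure set Rd -> \bar R}).
Hypothesis mu_P2 : P2 mu.
Hypothesis sigma_P2 : P2 sigma.
Hypothesis mu_ac : abs_cont mu.
Hypothesis sigma_ac : abs_cont sigma.

Local Notation c := (@cost R d tau).
Local Notation ADM := (ADM K W tau mu sigma).
Local Notation target_density := (target_density K tau W sigma).

Variables (gamma : G -> {measure set (Rd * Rd) -> \bar R}).
Variables (h : G -> G -> Rd -> R).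
Hypothesis adm : ADM gamma h.
Hypothesis mu_pos : forall g, {ae leb, forall x, (0 < density (mu g) x)%E}.
Hypothesis fbar_pos : forall g,
  {ae leb, forall x, (0 < fbar K W tau sigma h g x)%E}.
Hypothesis gamma_min : forall gamma' h', ADM gamma' h' ->
  (total_cost K W tau gamma h <= total_cost K W tau gamma' h')%E.

Let mh a b : measurable_fun setT (h a b). Proof. by case: adm. Qed.
Let ha a b y : h a b y = - h b a y.
Proof. by case: adm => _ _ H _ _; exact: H. Qed.

Let hgg a y : h a a y = 0. Proof. by have := ha a a y; lra. Qed.

Let target_null g A : measurable A -> gamma g (snd @^-1` A) = 0%E ->
  leb.-negligible A.
Proof.
move=> mA A0; apply: (positive_density_null (nu := snd_marginal (gamma g))
  (F := target_density h g)) => //.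
- exact: integrableR_measurable (target_density_integrable mW sigma_ac adm g).
- by apply: filterS (fbar_pos g) => x; rewrite fbarE// lte_fin.
- exact: (snd_marginal_density mW sigma_ac adm).
Qed.

Let source_null g A : measurable A -> gamma g (fst @^-1` A) = 0%E ->
  leb.-negligible A.
Proof.
move=> mA; rewrite (adm_fst adm)// => A0.
apply: (positive_density_null (nu := mu g) (F := sigma_density mu g)) => //.
- exact: integrableR_measurable (sigma_density_integrable mu_ac g).
- by apply: filterS (mu_pos g) => x; rewrite sigma_densityE// lte_fin.
- exact: (sigma_density_integral mu_ac).
Qed.

(** What holds at the targets of almost all pairs of the plan holds Lebesgue-almost everywhere. The
    exceptional set is required to be measurable because the projection of [B] need not be. *)
Let snd_null g (A : set Rd) (B : set (Rd * Rd)) : measurable A ->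
  (gamma g).-negligible (~` B) -> (forall p, B p -> ~ A p.2) ->
  leb.-negligible A.
Proof.
move=> mA nB AB; apply: (target_null (g := g)) => //.
apply: measure_negligible.
  by rewrite -[X in measurable X]setTI; exact: measurable_snd.
by apply: negligibleS nB => p Ap /AB.
Qed.

Let fst_null g (A : set Rd) (B : set (Rd * Rd)) : measurable A ->
  (gamma g).-negligible (~` B) -> (forall p, B p -> ~ A p.1) ->
  leb.-negligible A.
Proof.
move=> mA nB AB; apply: (source_null (g := g)) => //.
apply: measure_negligible.
  by rewrite -[X in measurable X]setTI; exact: measurable_fst.
by apply: negligibleS nB => p Ap /AB.
Qed.

Let J2 : finType := ('I_d + (bool + G * G))%type.

(** The quantities at a target that the cyclic perturbation needs bounded or nearly constant:
    coordinates, [W], the target density and all values of [h]. *)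
Let feat2 (g : G) (j : J2) (y : Rd) : R :=
  match j with
  | inl i => y ord0 i
  | inr (inl b) => if b then W y else target_density h g y
  | inr (inr ab) => h ab.1 ab.2 y
  end.

Let mfeat2 g j : measurable_fun setT (feat2 g j).
Proof.
case: j => [i|[[]|ab]].
- exact: measurable_coord.
- exact: mW.
- exact: integrableR_measurable (target_density_integrable mW sigma_ac adm g).
- exact: mh.
Qed.

Let J1 : finType := ('I_d + J2)%type.

Let feat (g : G) (j : J1) (p : Rd * Rd) : R :=
  match j with inl i => p.1 ord0 i | inr j' => feat2 g j' p.2 end.

Let mfeat g j : measurable_fun setT (feat g j).
Proof.
case: j => [i|j] /=.
  exact: (measurableT_comp (measurable_coord i) measurable_fst).
exact: (measurableT_comp (mfeat2 g j) measurable_snd).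
Qed.

Let Gam (g : G) : set (Rd * Rd) := typical (gamma g) (feat g).

Let ae_Gam g : (gamma g).-negligible (~` Gam g).
Proof. exact: ae_typical. Qed.

Let T := (G * (Rd * Rd))%type.
Let GamT : set T := [set n | Gam n.1 n.2].
Let adj (n n' : T) : Prop := n.1 = n'.1 \/ 0 < K n.1 n'.1.
Let w (n n' : T) : R :=
  c n.2.1 n'.2.2 - c n.2.1 n.2.2 + h n.1 n'.1 n'.2.2.

Let delta_exists (N : nat) (node : nat -> T) (e : R) : 0 < e ->
  exists2 t, 0 < t & forall i, (i < N)%N -> forall x y : Rd,
    (forall l, `|x ord0 l - (node i).2.1 ord0 l| < t) ->
    ((forall l, `|y ord0 l - (node i.+1).2.2 ord0 l| < t) ->
      `|c x y - c (node i).2.1 (node i.+1).2.2| < e) /\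
    ((forall l, `|y ord0 l - (node i).2.2 ord0 l| < t) ->
      `|c x y - c (node i).2.1 (node i).2.2| < e).
Proof.
move=> e0; elim: N => [|N [t t0 IH]]; first by exists 1.
have [t1 t10 H1] := continuous_cost tau_gt0 (node N).2.1 (node N.+1).2.2 e0.
have [t2 t20 H2] := continuous_cost tau_gt0 (node N).2.1 (node N).2.2 e0.
exists (Num.min t (Num.min t1 t2)); first by rewrite !lt_min t0 t10 t20.
have small (z z' : Rd) : (forall l, `|z ord0 l - z' ord0 l| <
    Num.min t (Num.min t1 t2)) -> [/\ forall l, `|z ord0 l - z' ord0 l| < t,
    forall l, `|z ord0 l - z' ord0 l| < t1 &
    forall l, `|z ord0 l - z' ord0 l| < t2].
  by move=> H; split => l; have := H l; rewrite !lt_min => /and3P[].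
move=> i; rewrite ltnS leq_eqVlt => /predU1P[->|iN] x y /small[hx hx1 hx2].
  by split => /small[hy hy1 hy2]; [exact: H1|exact: H2].
by have [K1 K2] := IH i iN x y hx; split => /small[hy hy1 hy2];
  [exact: K1|exact: K2].
Qed.

(** Small feature neighbourhoods of the nodes of the cycle serve as the sets [S i]: typicality gives
    them positive mass, and on them costs and [h] are within [e'] of their values at the nodes. *)
Lemma joint_cyclical_monotonicity p s : GamT p -> walk GamT adj p s ->
  last p s = p -> 0 <= walk_weight w p s.
Proof.
move=> Gp ws ls; case: s ws ls => [//|q s'] ws ls; set s := q :: s' in ws ls *.
pose N := size s; have N0 : (0 < N)%N by [].
have NR0 : 0 < (N%:R : R) by rewrite ltr0n.
pose node0 i := nth p (p :: s) i.
(* The perturbation is stated for sequences over all of nat, so the closed walk is continued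
   periodically. *)
pose node i := node0 (i %% N)%N.
have [hG hadj] := walk_nth Gp ws.
have node0N : node0 N = p by rewrite /node0 nth_last /= -/s -[RHS]ls.
have nodeE i : (i <= N)%N -> node i = node0 i.
  rewrite leq_eqVlt => /predU1P[->|iN]; first by rewrite /node modnn node0N.
  by rewrite /node modn_small.
have node_mod i : node i = node (i %% N)%N by rewrite /node modn_mod.
have node_modS i : node i.+1 = node (i %% N).+1.
  by rewrite /node -addn1 -modnDml addn1.
have modN i : (i %% N < N)%N by rewrite ltn_pmod.
have nodeG i : GamT (node i).
  rewrite node_mod (nodeE _ (ltnW (modN i))); exact: hG _ (ltnW (modN i)).
have nodeadj i : adj (node i) (node i.+1).
  rewrite node_mod node_modS (nodeE _ (ltnW (modN i))) (nodeE _ (modN i)).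
  exact: hadj _ (modN i).
have -> : walk_weight w p s = \sum_(i < N) w (node i) (node i.+1).
  rewrite walk_weight_sum; apply: eq_bigr => i _.
  by rewrite (nodeE _ (ltnW (ltn_ord i))) (nodeE _ (ltn_ord i)).
apply/ler_addgt0Pr => e e0.
(* Each of the [N] steps makes three errors, in [al], [be] and [th]. *)
pose e' := e / (3 * N%:R); have e'0 : 0 < e' by rewrite divr_gt0// mulr_gt0.
have [t1 t10 Ht1] := delta_exists N node e'0.
pose t := Num.min t1 (Num.min e' 1).
have t0 : 0 < t by rewrite !lt_min t10 e'0 ltr01.
have tt1 : t <= t1 by rewrite ge_min lexx.
have te' : t <= e' by rewrite !ge_min lexx orbT.
have t1' : t <= 1 by rewrite !ge_min lexx !orbT.
have Ht i (x y : Rd) : (forall l, `|x ord0 l - (node i).2.1 ord0 l| < t) ->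
    ((forall l, `|y ord0 l - (node i.+1).2.2 ord0 l| < t) ->
      `|c x y - c (node i).2.1 (node i.+1).2.2| < e') /\
    ((forall l, `|y ord0 l - (node i).2.2 ord0 l| < t) ->
      `|c x y - c (node i).2.1 (node i).2.2| < e').
  rewrite node_mod node_modS => hx.
  have [|K1 K2] := Ht1 _ (modN i) x y.
    by move=> l; exact: lt_le_trans (hx l) tt1.
  by split => hy; [apply: K1 => l|apply: K2 => l];
    exact: lt_le_trans (hy l) tt1.
(* The summand 1 absorbs the variation of a feature over its neighbourhood, since [t <= 1]. *)
pose B (n : T) : R := \sum_j `|feat2 n.1 j n.2.2| + 1.
have B0 n : 0 <= B n by rewrite addr_ge0// sumr_ge0.
pose M := \sum_(i < N) B (node i).
have M0 : 0 <= M by exact: sumr_ge0.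
have BM i : B (node i) <= M.
  rewrite node_mod /M (bigD1 (Ordinal (modN i)))//= lerDl; exact: sumr_ge0.
pose S i := feature_nbhs (feat (node i).1) (node i).2 t.
pose E i := feature_nbhs (feat2 (node i).1) (node i).2.2 t.
have EM i y j : E i y -> `|feat2 (node i).1 j y| <= M.
  move=> Ey; apply: le_trans (BM i); rewrite /B (bigD1 j)//=.
  have := Ey j; have := ler_normD (feat2 (node i).1 j y -
    feat2 (node i).1 j (node i).2.2) (feat2 (node i).1 j (node i).2.2).
  rewrite subrK; set r := \sum_(j' | _) _.
  by have : 0 <= r by [exact: sumr_ge0]; lra.
have := @cyclic_stationarity R d G K tau W K_ge0 K_sym tau_gt0 mW mu sigma
  mu_P2 sigma_P2 sigma_ac gamma h adm N (fun i => (node i).1) S E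
  (fun i => c (node i).2.1 (node i.+1).2.2 + e')
  (fun i => c (node i).2.1 (node i).2.2 - e')
  (fun i => h (node i).1 (node i.+1).1 (node i.+1).2.2 + e') M (Num.bound M).
have nodeN : node N = node 0 by rewrite node_mod modnn.
move=> H; have {H} : 0 <= \sum_(i < N)
    (c (node i).2.1 (node i.+1).2.2 + e' - (c (node i).2.1 (node i).2.2 - e') +
     (h (node i).1 (node i.+1).1 (node i.+1).2.2 + e')).
  apply: H => //.
  - by rewrite nodeN.
  - by rewrite /S nodeN.
  - by move=> i; apply: measurable_feature_nbhs; exact: mfeat.
  - by move=> i; apply: measurable_feature_nbhs; exact: mfeat2.
  - by move=> i; exact: nodeG.
  - by move=> i p' Sp j; exact: (Sp (inr j)).
  - move=> i y Ey l; rewrite in_itv/= -ler_norml.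
    exact: le_trans (EM i y (inl l) Ey) (ltW (archi_boundP M0)).
  - move=> i y Ey; apply: le_trans (EM i y (inr (inl false)) Ey).
    exact: ler_norm.
  - move=> i y Ey; apply: le_trans (EM i y (inr (inl true)) Ey).
    exact: ler_norm.
  - by move=> i a b y Ey; exact: (EM i y (inr (inr (a, b))) Ey).
  - move=> i p' q' Sp Sq; have [|K1 _] := Ht i p'.1 q'.2.
      by move=> l; exact: (Sp (inl l)).
    have : `|c p'.1 q'.2 - c (node i).2.1 (node i.+1).2.2| < e'.
      by apply: K1 => l; exact: (Sq (inr (inl l))).
    by rewrite ltr_distl => /andP[_ /ltW].
  - move=> i p' Sp; have [|_ K2] := Ht i p'.1 p'.2.
      by move=> l; exact: (Sp (inl l)).
    have : `|c p'.1 p'.2 - c (node i).2.1 (node i).2.2| < e'.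
      by apply: K2 => l; exact: (Sp (inr (inl l))).
    by rewrite ltr_distl => /andP[/ltW].
  - move=> i y Ey; have := Ey (inr (inr ((node i).1, (node i.+1).1))).
    rewrite /= ltr_distl => /andP[_ /ltW] H; apply: (le_trans H).
    by rewrite lerD2l.
rewrite (eq_bigr (fun i : 'I_N => w (node i) (node i.+1) + 3 * e')); last first.
  by move=> i _; rewrite /w; ring.
rewrite big_split/= sumr_const card_ord.
suff -> : (3 * e') *+ N = e by [].
rewrite -mulr_natr /e'; field; rewrite gt_eqF//.
Qed.

(** An empty set of typical pairs would make [gamma g] null and then, by positivity of the density
    of [mu g], the whole space Lebesgue-null. *)
Lemma Gam_nonempty g : Gam g !=set0.
Proof.
apply/set0P/eqP => G0; have := ae_Gam g; rewrite G0 setC0 => nT.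
have : leb.-negligible setT.
  apply: (fst_null (g := g) (B := set0)) => //.
  by rewrite setC0.
move=> /(measure_negligible measurableT) l0.
by have := @lebesgue_rV_setT R d; rewrite l0 ltxx.
Qed.

(** A path in the graph lifts by choosing any typical pair in each layer that it visits; a last step
    inside the layer of [q] reaches [q]. *)
Lemma Gam_connected p q : GamT p -> GamT q ->
  exists2 s, walk GamT adj p s & last p s = q.
Proof.
move=> Gp Gq; have [xG HxG] := choice Gam_nonempty.
have /connectP[s ps ls] := K_conn p.1 q.1.
exists (map (fun b => (b, xG b)) s ++ [:: q]); last by rewrite last_cat.
apply: walk_cat.
  elim: s p Gp ps {ls} => [//|b s IH] p Gp /= /andP[Kb pb]; split => //.
  - exact: HxG.
  - by right.
  - by apply: IH => //; exact: HxG.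
split => //; left; rewrite ls.
case: s {ps ls} => [//|b s] /=.
by rewrite (last_map (fun b => (b, xG b))).
Qed.

(* [phi g] is the shortest-path potential [D] on the pairs [(x, y)] of the
   support, extended to all of space as a [c]-concave envelope. *)
Lemma optimal_potential : exists phi, potentials K tau gamma h phi phi.
Proof.
have [D HD] := shortest_path_potential joint_cyclical_monotonicity
  Gam_connected.
pose b g (p : Rd * Rd) := c p.1 p.2 - D (g, p).
have Dle g p q : Gam g p -> Gam g q -> D (g, q) <= c p.1 q.2 - b g p.
  move=> Gp Gq; have := HD (g, p) (g, q) Gp Gq (or_introl erefl).
  by rewrite /w/= hgg /b; lra.
(* At the target of a typical pair [q] the bound is [D (g, q)]. These targets exhaust
   Lebesgue-almost every point, and the quadratic cost extends boundedness to every [y]. *)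
have bdd g y : exists M, forall p, Gam g p -> M <= c p.1 y - b g p.
  apply: (@bounded_below_everywhere _ _ tau _ (Gam g) fst (b g)).
  apply: (snd_null _ (ae_Gam g)).
    by apply: measurableC; exact: measurable_bounded_below.
  move=> q Gq; apply; exists (D (g, q)) => p Gp; exact: Dle.
have /choice[phi Hphi] g : exists phi, lower_envelope tau (Gam g) fst (b g) phi.
  exact: lower_envelope_exists (Gam_nonempty g) (bdd g).
(* The member [p = q] of the family gives one inequality; the other is [Dle], an edge inside the
   layer, where [h g g = 0]. *)
have phiD g q : Gam g q -> phi g q.2 = D (g, q).
  move=> Gq; apply/eqP; rewrite eq_le; apply/andP; split.
    by have := (Hphi g).1 q q.2 Gq; rewrite /b; lra.
  apply/ler_addgt0Pr => e e0; have [p Gp h1] := (Hphi g).2 q.2 e e0.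
  by have := Dle g p q Gp Gq; lra.
have mphi g := measurable_envelope tau_gt0 (Hphi g).
have phi_le g q y : Gam g q -> phi g y <= c q.1 y - c q.1 q.2 + phi g q.2.
  by move=> Gq; have := (Hphi g).1 q y Gq; rewrite /b phiD//; lra.
(* The same argument on the side of the sources makes the transform of [phi g] finite everywhere. *)
have bdd' g x : exists M, forall y, setT y -> M <= c (id y) x - phi g y.
  apply: (@bounded_below_everywhere _ _ tau _ setT id (phi g)).
  apply: (fst_null _ (ae_Gam g)).
    by apply: measurableC; exact: measurable_bounded_below.
  move=> q Gq; apply; exists (c q.1 q.2 - phi g q.2) => y _.
  by have := phi_le g q y Gq; rewrite costC/=; lra.
have /choice[psi Hpsi] g : exists psi, lower_envelope tau setT id (phi g) psi.
  by apply: lower_envelope_exists (bdd' g); exists 0.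
(* The edge inequality of [D] from [(g, p)] to [(g', q)], with the infimum taken over [p], at the
   targets of typical pairs of layer [g']. *)
have edge g g' : 0 < K g g' ->
    {ae leb, forall y, phi g' y <= phi g y + h g g' y}.
  move=> Kg; apply: (snd_null _ (ae_Gam g')).
    apply: measurableC; rewrite -[X in measurable X]setTI.
    by apply: measurable_fun_le => //; exact: measurable_funD.
  move=> q Gq; apply; rewrite /= phiD//.
  apply/ler_addgt0Pr => e e0; have [p Gp h1] := (Hphi g).2 q.2 e e0.
  have := HD (g, p) (g', q) Gp Gq (or_intror Kg).
  by move: h1; rewrite /w/= /b; lra.
exists phi; split.
- move=> g; split; first exact: c_concave_envelope (Hphi g) (Hpsi g).
  apply: negligibleS (ae_Gam g) => p /= H Gp; apply: H.
  rewrite (c_superdiffE (Hpsi g))/=.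
  suff -> : psi g p.1 = c p.1 p.2 - phi g p.2 by rewrite subrK.
  apply/eqP; rewrite eq_le; apply/andP; split.
    by have := (Hpsi g).1 p.2 p.1 I; rewrite costC.
  apply/ler_addgt0Pr => e e0; have [y _ h1] := (Hpsi g).2 p.1 e e0.
  by have := phi_le g p y Gp; move: h1; rewrite costC/=; lra.
- suff : {ae leb, forall y (gg : G * G), 0 < K gg.1 gg.2 ->
      phi gg.2 y <= phi gg.1 y + h gg.1 gg.2 y}.
    apply: filterS => y H g g' Kg; have := H (g, g') Kg.
    have := H (g', g); rewrite /= K_sym => /(_ Kg); rewrite (ha g' g); lra.
  apply: ae_forall_fin => -[g g'] /=.
  have [Kg|nK] := pselect (0 < K g g'); last exact/aeW.
  by apply: filterS (edge g g' Kg).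
- split => [g|eps _].
    under eq_fun do rewrite subrr; split => // A cA.
    by under eq_integral do rewrite expr0n; rewrite integral0.
  under eq_integral do (under eq_bigr do rewrite subrr mul0r; rewrite big1//).
  by rewrite integral0.
Qed.

End necessity.

(** * From two potentials to a single one *)

Section merging.
Context {R : realType} {d : nat} {G : finType}.
Notation Rd := 'rV[R]_d.
Notation leb := (@lebesgue_rV R d).
Variables (K : G -> G -> R) (tau : R).
Variables (gamma : G -> {measure set (Rd * Rd) -> \bar R}).
Variables (h : G -> G -> Rd -> R).

(* [phi - psi] splits as [a y + b g] almost everywhere; absorbing [b] into
   [phi] leaves [a] only, which is invisible to differences in [g]. *)
Lemma merge_potentials (phi psi : G -> Rd -> R) :
  potentials K tau gamma h phi psi ->
  exists phi', potentials K tau gamma h phi' phi'.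
Proof.
move=> [cphi hpsi orth].
(* A reference layer [g0] is needed to define [b]; for empty [G] all the conditions are trivial. *)
have [[g0 _]|G0] := pselect (exists g0 : G, True); last first.
  exists phi; split => // [|].
    by apply/aeW => y g; exfalso; apply: G0; exists g.
  split => [g|eps _]; first by exfalso; apply: G0; exists g.
  under eq_integral do (under eq_bigr do rewrite subrr mul0r; rewrite big1//).
  by rewrite integral0.
have /choice[b Hb] : forall g, exists b, {ae leb, forall y,
    phi g y - psi g y - (phi g0 y - psi g0 y) = b}.
  by move=> g; exact: (Phi_orth_ae_const orth).
exists (fun g y => phi g y - b g); split.
- move=> g; have [cg ng] := cphi g.
  by have [cg' ->] := c_concave_shift (b g) cg.
- apply: filterS2 hpsi (ae_forall_fin Hb) => y Hy Hby g g' Kg.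
  by rewrite -(Hy g g' Kg) -(Hby g) -(Hby g'); ring.
- split => [g|eps _].
    under eq_fun do rewrite subrr; split => // A cA.
    by under eq_integral do rewrite expr0n; rewrite integral0.
  under eq_integral do (under eq_bigr do rewrite subrr mul0r; rewrite big1//).
  by rewrite integral0.
Qed.

End merging.

Theorem proposition4p5 (R : realType) (d : nat) (d_gt0 : (0 < d)%N)
    (G : finType) (K : G -> G -> R)
    (K_ge0 : forall g g', 0 <= K g g')
    (K_sym : forall g g', K g g' = K g' g)
    (K_conn : forall g g', connect (fun a b => 0 < K a b) g g')
    (tau : R) (tau_gt0 : 0 < tau)
    (W : 'rV[R]_d -> R) (W_sobolev : W12loc W)
    (W_moment :
      (\int[lebesgue_rV d]_x (sqnorm x * expR (- W x))%:E < +oo)%E)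
    (mu sigma : G -> {finite_measure set 'rV[R]_d -> \bar R})
    (mu_P2 : P2 mu) (sigma_P2 : P2 sigma)
    (mu_ac : abs_cont mu) (sigma_ac : abs_cont sigma)
    (cost_fin : (min_cost K W tau mu sigma < +oo)%E)
    (gamma : G -> {measure set ('rV[R]_d * 'rV[R]_d) -> \bar R})
    (h : G -> G -> 'rV[R]_d -> R)
    (adm : ADM K W tau mu sigma gamma h)
    (mu_pos : forall g,
      {ae lebesgue_rV d, forall x, (0 < density (mu g) x)%E})
    (fbar_pos : forall g,
      {ae lebesgue_rV d, forall x, (0 < fbar K W tau sigma h g x)%E}) :
  [<-> forall gamma' h', ADM K W tau mu sigma gamma' h' ->
         (total_cost K W tau gamma h <= total_cost K W tau gamma' h')%E;
       exists phi psi : G -> 'rV[R]_d -> R, potentials K tau gamma h phi psi;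
       exists phi : G -> 'rV[R]_d -> R, potentials K tau gamma h phi phi].
Proof.
have mW := W_sobolev.1.1; split; last split.
- move=> gamma_min.
  have [phi Hphi] := optimal_potential K_ge0 K_sym K_conn tau_gt0 mW mu_P2
    sigma_P2 mu_ac sigma_ac adm mu_pos fbar_pos gamma_min.
  by exists phi, phi.
- by move=> [phi [psi]]; exact: merge_potentials.
- move=> [phi Hphi] gamma' h' adm'.
  exact: (potentials_sufficient K_ge0 K_sym tau_gt0 mW mu_P2 sigma_P2 sigma_ac
    adm adm' Hphi).
Qed.
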